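(* For every arc $I\subset\mathbb{T}$ with $I\neq\mathbb{T}$ and every $\omega>0$, $$\sup_{F\in\mathcal{S}^*(\mathbb{Z}),\ \|F\|_{\ell^2(\mathbb{Z})}\leqslant\omega}\ \inf_{z\in I}\ \sup_{N\in\mathbb{Z}^+}\big|\arg\mathfrak{a}^{( * )}(z,F^{\langle N\rangle})\big|=+\infty.$$
   Context: $\mathbb{T}$, $\mathbb{D}$ are the unit circle and open unit disc, $\mathbb{Z}^+=\{0,1,\dots\}$, $m$ is normalized Lebesgue measure on $\mathbb{T}$. $\mathcal{S}^*(\mathbb{Z})$ is the set of sequences $F=\{F_n\}_{n\in\mathbb{Z}}$ with $\sup_n|F_n|<1$ and, for every $\ell\in\mathbb{Z}^+$, $|F_n|\leqslant C_\ell(1+|n|)^{-\ell}$ for all $n$. Truncation: $F^{\langle N\rangle}_n=F_n\chi_{|n|\leqslant N}$. For a finitely supported sequence $G$ with values in $\mathbb{D}$: let $\widetilde X_n(z)=I$ for $n$ below the support of $G$ and $\widetilde X_n=(1-|G_n|^2)^{-1/2}\begin{pmatrix}1&\overline{G_n}z^{-n}\\ G_nz^n&1\end{pmatrix}\widetilde X_{n-1}$; for $n$ above the support $\widetilde X_n=\begin{pmatrix}\mathfrak{a}(z,G)&\mathfrak{b}^{( * )}(z,G)\\ \mathfrak{b}(z,G)&\mathfrak{a}^{( * )}(z,G)\end{pmatrix}$ with $f^{( * )}(z)=\overline{f(\bar z^{-1})}$. Then $\mathfrak{a}^{( * )}(\cdot,G)$ is analytic in $\mathbb{D}$, continuous on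 $\overline{\mathbb{D}}$, outer, with $|\mathfrak{a}^{( * )}(\xi,G)|^2=1+|\mathfrak{b}(\xi,G)|^2$ on $\mathbb{T}$ and $\mathfrak{a}^{( * )}(0,G)>0$. Its argument is defined by $\arg\mathfrak{a}^{( * )}(z,G)=\frac12\int_{\mathbb{T}}\operatorname{Im}\big(\frac{\xi+z}{\xi-z}\big)\log(1+|\mathfrak{b}(\xi,G)|^2)\,dm(\xi)$ for $z\in\mathbb{D}$, and for $z=e^{i\phi}\in\mathbb{T}$ by the principal-value integral $\arg\mathfrak{a}^{( * )}(e^{i\phi},G)=\frac1{4\pi}\,\mathrm{p.v.}\int_0^{2\pi}\cot\big(\frac{\phi-\theta}2\big)\log(1+|\mathfrak{b}(e^{i\theta},G)|^2)\,d\theta$. *)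

(* Defs.v *)
From HB Require Import structures.
From mathcomp Require Import all_boot all_order all_algebra.
From mathcomp Require Import complex.
From mathcomp Require Import all_classical all_reals all_analysis.

Set Implicit Arguments.
Unset Strict Implicit.
Unset Printing Implicit Defensive.
Import Order.TTheory GRing.Theory Num.Theory.
Import numFieldNormedType.Exports.
Local Open Scope classical_set_scope.
Local Open Scope ring_scope.

Section NLFT.
Variable R : realType.
Local Notation C := R[i].

Definition sqmod (x : C) : R := complex.Re x ^+ 2 + complex.Im x ^+ 2.

Definition expi (t : R) : C := Complex (cos t) (sin t).

Definition circleT : set C := [set z | sqmod z = 1].

Definition circ_arc (I : set C) : Prop :=
  exists J : interval R, I = [set expi t | t in [set` J]].

Definition Sstar (F : int -> C) : Prop :=
  (exists c : R, c < 1 /\ forall n, Num.sqrt (sqmod (F n)) <= c) /\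
  (forall l : nat, exists Cl : R, forall n : int,
      Num.sqrt (sqmod (F n)) <= Cl * ((1 + `|n|%:R) ^- l)).

Definition l2normsq (F : int -> C) : \bar R :=
  (\esum_(n in [set: int]) (sqmod (F n))%:E)%E.

Definition trunc (F : int -> C) (N : nat) : int -> C :=
  fun n => if (absz n <= N)%N then F n else 0.

Definition factor (G : int -> C) (n : int) (z : C) : 'M[C]_2 :=
  real_complex R ((Num.sqrt (1 - sqmod (G n)))^-1) *:
  \matrix_(i < 2, j < 2)
     (if i == j then 1
      else if (val i == 0)%N then conjc (G n) * z ^ (- n)
      else G n * z ^ n).

(* for G supported in [-N, N]:  X = M_N M_{N-1} ... M_{-N} *)
Definition transfer (G : int -> C) (N : nat) (z : C) : 'M[C]_2 :=
  \prod_(i < (N + N).+1) factor G (N%:Z - i%:Z) z.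

Definition bcoef (G : int -> C) (N : nat) (z : C) : C :=
  transfer G N z 1 0.

(* arg a^{(star)}(z, G) for z in T, by the principal value integral
   (1/4pi) p.v. int_0^{2pi} cot((phi - theta)/2) log(1+|b(e^{i theta})|^2) dtheta
   where z = e^{i phi};  cot((phi-theta)/2) = Im((xi+z)/(xi-z)) for xi = e^{i theta}.
   The p.v. removes the theta with |e^{i theta} - z| < eps. *)
Definition pv_trunc (G : int -> C) (N : nat) (z : C) (eps : R) : R :=
  Rintegral lebesgue_measure
    [set t : R | 0 <= t <= 2 * pi /\ eps <= Num.sqrt (sqmod (expi t - z))]
    (fun t => complex.Im ((expi t + z) / (expi t - z))
              * ln (1 + sqmod (bcoef G N (expi t)))).

Definition arg_astar (G : int -> C) (N : nat) (z : C) : R :=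
  (4 * pi)^-1 * lim (pv_trunc G N z eps @[eps --> 0^'+]).

End NLFT.

(* Main.v *)
Require Import Defs.
From HB Require Import structures.
From mathcomp Require Import all_boot all_order all_algebra.
From mathcomp Require Import complex.
From mathcomp Require Import all_classical all_reals all_analysis.
From mathcomp Require Import ring lra zify.
Import Order.TTheory GRing.Theory Num.Theory.
Import numFieldNormedType.Exports.
Local Open Scope classical_set_scope.
Local Open Scope ring_scope.
Set Implicit Arguments.
Unset Strict Implicit.
Unset Printing Implicit Defensive.

(** The coefficients of [F] are read off one at a time: with [y_0 = 0] and
    [y_(m+1) = z (y_m + conj F_m) / (1 + F_m y_m)] one has [|y_m| <= 1] on the
    closed disc, and a^( * ) is, up to a positive factor, the product of the
    [1 + F_m y_m], each of positive real part.  Uniqueness of continuous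
    arguments along the ray from 0 to [z] then gives
    [arg a^( * )(z) = sum_m Arg (1 + F_m y_m)].

    Let [F] consist of [k] blocks, block [l] being a long pure frequency at the
    angle [2 pi l / k], of l^2-mass [w^2 / k].  As the blocks get longer, block
    [l] adds [(w^2 / (2 k)) cot ((phi - 2 pi l / k) / 2)] to the argument at
    [e^(i phi)], up to a small error, for every [phi] away from its frequency
    and whatever the earlier blocks did: changing the initial value [y_0] of a
    block changes its contribution by [Arg (1 + y_0 rho)] with [rho] small.
    The blocks on one side of [phi] add up to about [w^2 log k], so
    two truncations of [F] have arguments at [e^(i phi)] that far apart, and
    one of them is large. *)

(** The ratio $y_m$ is $z^m\overline{b}/a^\ast$ for the product of the first $m$ factors; the twist
    $z^m$ gives the recursion the same form at every step. As $F$ vanishes at negative indices, the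
    truncation at $N$ consists exactly of $F_0,\dots,F_N$.

    The obstacle is nonlinearity: each block starts from a value that depends on all earlier ones,
    and the block estimate says nothing about a frequency too close to $z$. Comparing two
    truncations removes both difficulties, since only the blocks between them matter; these are
    chosen on one side of $\phi$, at least one spacing away, where the kernel keeps its sign.

    The principal value is reached through the roots: up to a constant, $a^\ast$ is a product of
    factors $1-wx$ with $|w|<1$, and the conjugate function of $\log|1-wx|^2$ is
    $2\,\mathrm{Arg}(1-wx)$. The ray argument then exchanges the sum over roots for the sum over
    coefficients.

    The norm is lowered to at most $1/8$, so that the linearized recursion is accurate already one
    spacing away from the frequency. *)

Section Modulus.
Variable R : realType.
Local Notation C := R[i].
Implicit Types (x y z : C).

Definition cabs z : R := Num.sqrt (sqmod z).

Lemma sqmod_ge0 z : 0 <= sqmod z.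
Proof. by rewrite /sqmod addr_ge0 ?sqr_ge0. Qed.

Lemma sqmodM x y : sqmod (x * y) = sqmod x * sqmod y.
Proof. by case: x y => [a b] [c d]; rewrite /sqmod /=; ring. Qed.

Lemma sqmodJ z : sqmod (conjc z) = sqmod z.
Proof. by case: z => a b; rewrite /sqmod /= sqrrN. Qed.

Lemma sqmod1 : sqmod (1 : C) = 1.
Proof. by rewrite /sqmod /= expr0n expr1n addr0. Qed.

Lemma sqmod0 : sqmod (0 : C) = 0.
Proof. by rewrite /sqmod /= expr0n addr0. Qed.

Lemma sqmod_eq0 z : (sqmod z == 0) = (z == 0).
Proof.
case: z => a b; rewrite /sqmod /= paddr_eq0 ?sqr_ge0 // !sqrf_eq0.
by rewrite eq_complex.
Qed.

Lemma sqmodV z : sqmod z^-1 = (sqmod z)^-1.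
Proof.
have [->|z0] := eqVneq z 0; first by rewrite invr0 sqmod0 invr0.
have s0 : sqmod z != 0 by rewrite sqmod_eq0.
by apply: (mulfI s0); rewrite -sqmodM divff // sqmod1 divff.
Qed.

Lemma sqmod_real (r : R) : sqmod (real_complex R r) = r ^+ 2.
Proof. by rewrite /sqmod /= expr0n addr0. Qed.

Lemma sqmod_expi (t : R) : sqmod (expi t) = 1.
Proof. exact: cos2Dsin2. Qed.

Lemma mulJc z : z * conjc z = real_complex R (sqmod z).
Proof. by case: z => a b; rewrite /sqmod; simpc; congr Complex; ring. Qed.

Lemma cabs_sq z : cabs z ^+ 2 = sqmod z.
Proof. by rewrite sqr_sqrtr ?sqmod_ge0. Qed.

Lemma cabs_ge0 z : 0 <= cabs z.
Proof. exact: sqrtr_ge0. Qed.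

Lemma cabsM x y : cabs (x * y) = cabs x * cabs y.
Proof. by rewrite /cabs sqmodM sqrtrM ?sqmod_ge0. Qed.

Lemma cabsV z : cabs z^-1 = (cabs z)^-1.
Proof. by rewrite /cabs sqmodV sqrtrV ?sqmod_ge0. Qed.

Lemma cabsJ z : cabs (conjc z) = cabs z.
Proof. by rewrite /cabs sqmodJ. Qed.

Lemma cabs1 : cabs 1 = 1.
Proof. by rewrite /cabs sqmod1 sqrtr1. Qed.

Lemma cabs0 : cabs 0 = 0.
Proof. by rewrite /cabs sqmod0 sqrtr0. Qed.

Lemma cabsX z n : cabs (z ^+ n) = cabs z ^+ n.
Proof. by elim: n => [|n IH]; rewrite ?cabs1 // !exprS cabsM IH. Qed.

Lemma cabs_eq0 z : (cabs z == 0) = (z == 0).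
Proof. by rewrite -sqrf_eq0 cabs_sq sqmod_eq0. Qed.

Lemma cabs_gt0 z : (0 < cabs z) = (z != 0).
Proof. by rewrite lt0r cabs_ge0 andbT cabs_eq0. Qed.

Lemma cabsN z : cabs (- z) = cabs z.
Proof. by case: z => a b; rewrite /cabs /sqmod /= !sqrrN. Qed.

Lemma cabsE z : cabs z = ComplexField.Normc.normc z.
Proof. by case: z. Qed.

Lemma cabsD x y : cabs (x + y) <= cabs x + cabs y.
Proof. by rewrite !cabsE; exact: le_normcD. Qed.

Lemma cabs_real (r : R) : cabs (real_complex R r) = `|r|.
Proof. by rewrite /cabs sqmod_real sqrtr_sqr. Qed.

Lemma cabs_expi (t : R) : cabs (expi t) = 1.
Proof. by rewrite /cabs sqmod_expi sqrtr1. Qed.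

Lemma Re_cabs z : `|complex.Re z| <= cabs z.
Proof. by rewrite -sqrtr_sqr ler_wsqrtr // /sqmod lerDl sqr_ge0. Qed.

Lemma Im_cabs z : `|complex.Im z| <= cabs z.
Proof. by rewrite -sqrtr_sqr ler_wsqrtr // /sqmod lerDr sqr_ge0. Qed.

Lemma cabs_sum n (f : nat -> C) :
  cabs (\sum_(i < n) f i) <= \sum_(i < n) cabs (f i).
Proof.
elim: n => [|n IH]; first by rewrite !big_ord0 cabs0.
by rewrite !big_ord_recr /= (le_trans (cabsD _ _)) // lerD2r.
Qed.

Lemma cabs_le1 z : (cabs z <= 1) = (sqmod z <= 1).
Proof. by rewrite -[1 in LHS]sqrtr1 ler_sqrt. Qed.

Lemma cabs_eq1 z : sqmod z = 1 -> cabs z = 1.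
Proof. by rewrite /cabs => ->; rewrite sqrtr1. Qed.

Lemma Re_1D_gt0 z : cabs z < 1 -> 0 < complex.Re (1 + z).
Proof.
move=> z1; have := Re_cabs z; case: z z1 => a b /= z1.
by rewrite ler_norml => /andP[]; lra.
Qed.

Lemma Re_1D_gt0M x y : cabs x < 1 -> cabs y <= 1 -> 0 < complex.Re (1 + x * y).
Proof.
move=> x1 y1; apply: Re_1D_gt0; rewrite cabsM.
by apply: le_lt_trans x1; rewrite ler_piMr ?cabs_ge0.
Qed.

Lemma Re_gt0_neq0 z : 0 < complex.Re z -> z != 0.
Proof. by move=> z0; apply: contraTneq z0 => ->; rewrite ltxx. Qed.

Lemma expiD (s t : R) : expi (s + t) = expi s * expi t.
Proof.
by rewrite /expi cosD sinD; simpc; congr Complex; rewrite addrC.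
Qed.

Lemma expi0 : expi (0 : R) = 1.
Proof. by rewrite /expi cos0 sin0. Qed.

Lemma expiN (t : R) : expi (- t) = conjc (expi t).
Proof. by rewrite /expi cosN sinN. Qed.

Lemma conj_unit z : sqmod z = 1 -> conjc z * z = 1.
Proof. by move=> z1; rewrite mulrC mulJc z1. Qed.

End Modulus.

(** * The recursion for $y_m$ and its linear form in U(1,1) *)

Section Chain.
Variable R : realType.
Local Notation C := R[i].
Implicit Types (G : nat -> C) (z y : C).

(** This is the principal argument on the open right half-plane only; the lemmas that use it as an
    argument assume a positive real part. *)
Definition arg z : R := atan (complex.Im z / complex.Re z).

Fixpoint chain G z y n : C :=
  if n is m.+1 then
    z * (chain G z y m + conjc (G m)) / (1 + G m * chain G z y m)
  else y.

Definition chain_arg G z y n : R := \sum_(m < n) arg (1 + G m * chain G z y m).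

(* [chain] is the projectivized action of [lin] on pairs (a, Y), y = Y / a. *)
Fixpoint lin G z (v : C * C) n : C * C :=
  if n is m.+1 then
    let p := lin G z v m in
    (p.1 + G m * p.2, z * (p.2 + conjc (G m) * p.1))
  else v.

(** A Möbius map of the disc followed by a contraction: $|1+gy|^2-|y+\bar
    g|^2=(1-|g|^2)(1-|y|^2)$. *)
Lemma chain_step_le1 (g y z : C) : cabs g < 1 -> cabs z <= 1 -> cabs y <= 1 ->
  cabs (z * (y + conjc g) / (1 + g * y)) <= 1.
Proof.
move=> g1 z1 y1; rewrite !cabsM cabsV.
have d0 : 0 < cabs (1 + g * y).
  by rewrite cabs_gt0 Re_gt0_neq0 // Re_1D_gt0M.
rewrite ler_pdivrMr // mul1r.
apply: (@le_trans _ _ (cabs (y + conjc g))).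
  by rewrite ler_piMl ?cabs_ge0.
rewrite ler_wsqrtr //.
have g2 : 0 <= 1 - sqmod g.
  by rewrite subr_ge0 -cabs_le1 ltW.
have y2 : 0 <= 1 - sqmod y by rewrite subr_ge0 -cabs_le1.
have := mulr_ge0 g2 y2.
case: g y {d0 g1 y1 g2 y2} => [a b] [c d]; rewrite /sqmod; simpc => /=.
by rewrite -subr_ge0 => h; rewrite -subr_ge0; congr (0 <= _): h; ring.
Qed.

Lemma chain_le1 G z y n : (forall m, cabs (G m) < 1) -> cabs z <= 1 ->
  cabs y <= 1 -> cabs (chain G z y n) <= 1.
Proof.
by move=> G1 z1 y1; elim: n => [//|n IH] /=; exact: chain_step_le1.
Qed.

Lemma chain_Re_gt0 G z y n : (forall m, cabs (G m) < 1) -> cabs z <= 1 ->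
  cabs y <= 1 -> 0 < complex.Re (1 + G n * chain G z y n).
Proof. by move=> G1 z1 y1; exact/Re_1D_gt0M/chain_le1. Qed.

Lemma linE G z y n : (forall m, cabs (G m) < 1) -> cabs z <= 1 ->
  cabs y <= 1 ->
  (lin G z (1, y) n).1 = \prod_(m < n) (1 + G m * chain G z y m) /\
  (lin G z (1, y) n).2 = chain G z y n * (lin G z (1, y) n).1.
Proof.
move=> G1 z1 y1; elim: n => [|n [IH1 IH2]]; first by rewrite big_ord0 /= mulr1.
have h0 := Re_gt0_neq0 (chain_Re_gt0 n G1 z1 y1).
rewrite big_ord_recr /= -IH1 IH2; split; first by ring.
by field.
Qed.

Lemma lin_linear G z y n :
  (lin G z (1, y) n).1 = (lin G z (1, 0) n).1 + y * (lin G z (0, 1) n).1 /\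
  (lin G z (1, y) n).2 = (lin G z (1, 0) n).2 + y * (lin G z (0, 1) n).2.
Proof.
elim: n => [|n [IH1 IH2]] /=; first by rewrite mulr0 mulr1 addr0 add0r.
by rewrite IH1 IH2; split; ring.
Qed.

Definition defect G n : R := \prod_(m < n) (1 - sqmod (G m)).

Lemma defect_gt0 G n : (forall m, cabs (G m) < 1) -> 0 < defect G n.
Proof.
move=> G1; apply: prodr_gt0 => m _.
by rewrite subr_gt0 -cabs_sq expr_lt1 ?cabs_ge0.
Qed.

(** For $|z|=1$ each step multiplies the form $|a|^2-|Y|^2$ by $1-|G_m|^2$, so the two columns stay
    orthogonal for it, with norms of opposite sign. *)
Lemma lin_unitary G z n : sqmod z = 1 ->
  [/\ sqmod (lin G z (1, 0) n).1 - sqmod (lin G z (1, 0) n).2 = defect G n,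
      sqmod (lin G z (0, 1) n).1 - sqmod (lin G z (0, 1) n).2 = - defect G n &
      (lin G z (1, 0) n).1 * conjc (lin G z (0, 1) n).1 =
      (lin G z (1, 0) n).2 * conjc (lin G z (0, 1) n).2].
Proof.
move=> z1; elim: n => [|n].
  rewrite /defect big_ord0 /= sqmod1 sqmod0 subr0 sub0r.
  by split=> //; simpc.
rewrite /defect big_ord_recr /= -/(defect G n); set D := defect G n.
case: (lin G z (1, 0) n) => a Y; case: (lin G z (0, 1) n) => b W /= [h1 h2 h3].
split.
- rewrite sqmodM z1 mul1r -h1.
  case: (G n) a Y {h1 h2 h3} => [g g'] [a a'] [Y Y']; rewrite /sqmod /=; ring.
- rewrite sqmodM z1 mul1r -mulNr -h2.
  case: (G n) b W {h1 h2 h3} => [g g'] [b b'] [W W']; rewrite /sqmod /=; ring.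
- have zz : z * conjc z = 1 by rewrite mulJc z1.
  rewrite !rmorphM /= !rmorphD /= !rmorphM /=.
  have -> : conjc (conjc (G n)) = G n by case: (G n) => u v /=; rewrite opprK.
  set g := G n; set gb := conjc g; set bb := conjc b in h3 *; set Wb := conjc W in h3 *.
  transitivity (z * conjc z * ((Y + gb * a) * (Wb + g * bb))); last by ring.
  by rewrite zz mul1r; apply/eqP; rewrite -subr_eq0; apply/eqP;
     transitivity ((a * bb - Y * Wb) * (1 - g * gb)); [ring|rewrite h3 subrr mul0r].
Qed.

(** The off-diagonal entries of a multiple of a U(1,1) matrix have equal modulus. This is what
    bounds the influence of the initial value by the final value of the chain started at 0. *)
Lemma lin_sqmod_swap G z n : (forall m, cabs (G m) < 1) -> sqmod z = 1 ->
  sqmod (lin G z (0, 1) n).1 = sqmod (lin G z (1, 0) n).2.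
Proof.
move=> G1 z1; have [h1 h2 h3] := lin_unitary G n z1.
have := congr1 (@sqmod R) h3; rewrite !sqmodM !sqmodJ.
have p0 := defect_gt0 n G1.
set a := sqmod (lin G z (1, 0) n).1 in h1 *.
set Y := sqmod (lin G z (1, 0) n).2 in h1 *.
set b := sqmod (lin G z (0, 1) n).1 in h2 *.
set W := sqmod (lin G z (0, 1) n).2 in h2 *.
set p := defect G n in h1 h2 p0 * => h4.
have h : p * (b - Y) = 0.
  have h5 : W = b + p by rewrite -[p]opprK -h2; ring.
  have h6 : Y = a - p by rewrite -h1; ring.
  transitivity (a * b - Y * W); first by rewrite h5 h6; ring.
  by rewrite h4 subrr.
by move/eqP: h; rewrite mulf_eq0 (gt_eqF p0) subr_eq0 => /eqP.
Qed.

Lemma chain_addn G z y n m :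
  chain G z y (n + m) = chain (fun i => G (n + i)%N) z (chain G z y n) m.
Proof. by elim: m => [|m IH]; rewrite ?addn0 // addnS /= IH. Qed.

Lemma chain_arg_addn G z y n m : chain_arg G z y (n + m) =
  chain_arg G z y n + chain_arg (fun i => G (n + i)%N) z (chain G z y n) m.
Proof.
rewrite /chain_arg big_split_ord /=; congr (_ + _).
by apply: eq_bigr => i _; rewrite chain_addn.
Qed.

Lemma eq_chain G H z y n : (forall m, (m < n)%N -> G m = H m) ->
  chain G z y n = chain H z y n.
Proof.
elim: n => [//|n IH] GH /=; rewrite IH ?GH // => m mn; apply: GH.
exact: ltnW.
Qed.

Lemma eq_chain_arg G H z y n : (forall m, (m < n)%N -> G m = H m) ->
  chain_arg G z y n = chain_arg H z y n.
Proof.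
move=> GH; apply: eq_bigr => m _; rewrite GH // (@eq_chain G H) // => j jm.
by apply: GH; exact: ltn_trans jm (ltn_ord m).
Qed.

(* A modulation of the coefficients is a rotation of the spectral variable. *)
Lemma chain_modulated (e : C) (zeta z y : C) n : sqmod zeta = 1 ->
  chain (fun m => e * conjc zeta ^+ m) z y n =
  zeta ^+ n * chain (fun=> e) (z * conjc zeta) y n.
Proof.
move=> u1; elim: n => [|n IH]; first by rewrite mul1r.
have cu := conj_unit u1.
have cun : conjc zeta ^+ n * zeta ^+ n = 1 by rewrite -exprMn cu expr1n.
have u0 : zeta != 0 by rewrite -sqmod_eq0 u1 oner_eq0.
rewrite /= IH !rmorphM !rmorphXn /= conjcK.
set c := chain _ _ _ _; rewrite -mulrA.
have -> : e * conjc zeta ^+ n * (zeta ^+ n * c) =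
  e * c * (conjc zeta ^+ n * zeta ^+ n) by ring.
rewrite cun mulr1 exprS.
transitivity (zeta ^+ n * z * (c + conjc e) / (1 + e * c)); first by ring.
rewrite -[in LHS](mulr1 z) -cu.
by ring.
Qed.

Lemma chain_arg_modulated (e : C) (zeta z y : C) n : sqmod zeta = 1 ->
  chain_arg (fun m => e * conjc zeta ^+ m) z y n =
  chain_arg (fun=> e) (z * conjc zeta) y n.
Proof.
move=> u1; apply: eq_bigr => m _; rewrite chain_modulated //.
have cun : conjc zeta ^+ m * zeta ^+ m = 1.
  by rewrite -exprMn conj_unit ?expr1n.
congr (arg (1 + _)); set c := chain _ _ _ _.
transitivity (e * c * (conjc zeta ^+ m * zeta ^+ m)); first by ring.
by rewrite cun mulr1.
Qed.

End Chain.

(** * Derivatives of complex paths and the Taylor remainder of the logarithm *)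

Section ComplexPaths.
Variable R : realType.
Local Notation C := R[i].
Implicit Types (f g : R -> C) (t : R) (d e : C).

Definition cderive f t d : Prop :=
  is_derive t 1 (fun s => complex.Re (f s)) (complex.Re d) /\
  is_derive t 1 (fun s => complex.Im (f s)) (complex.Im d).

Lemma cderive_cst (c : C) t : cderive (fun=> c) t 0.
Proof. by split; exact: is_derive_cst. Qed.

Lemma cderive_real t : cderive (fun s => real_complex R s) t 1.
Proof. by split; [exact: is_derive_id|exact: is_derive_cst]. Qed.

Lemma cderiveD f g t d e : cderive f t d -> cderive g t e ->
  cderive (fun s => f s + g s) t (d + e).
Proof.
move=> [f1 f2] [g1 g2]; split.
- have -> : (fun s => complex.Re (f s + g s)) =
    (fun s => complex.Re (f s)) + (fun s => complex.Re (g s)).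
    by apply/funext => s; rewrite !fctE; case: (f s); case: (g s).
  by apply: is_derive_eq; case: d {f1 f2}; case: e {g1 g2}.
- have -> : (fun s => complex.Im (f s + g s)) =
    (fun s => complex.Im (f s)) + (fun s => complex.Im (g s)).
    by apply/funext => s; rewrite !fctE; case: (f s); case: (g s).
  by apply: is_derive_eq; case: d {f1 f2}; case: e {g1 g2}.
Qed.

Lemma cderiveM f g t d e : cderive f t d -> cderive g t e ->
  cderive (fun s => f s * g s) t (d * g t + f t * e).
Proof.
move=> [f1 f2] [g1 g2]; split.
- have -> : (fun s => complex.Re (f s * g s)) =
    (fun s => complex.Re (f s)) * (fun s => complex.Re (g s)) -
    (fun s => complex.Im (f s)) * (fun s => complex.Im (g s)).
    by apply/funext => s; rewrite !fctE; case: (f s); case: (g s).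
  apply: is_derive_eq (is_deriveB (is_deriveM f1 g1) (is_deriveM f2 g2)) _.
  rewrite /GRing.scale /=.
  by case: d {f1 f2} => ? ?; case: e {g1 g2} => ? ?; case: (f t) => ? ?;
     case: (g t) => ? ? /=; ring.
- have -> : (fun s => complex.Im (f s * g s)) =
    (fun s => complex.Re (f s)) * (fun s => complex.Im (g s)) +
    (fun s => complex.Im (f s)) * (fun s => complex.Re (g s)).
    by apply/funext => s; rewrite !fctE; case: (f s); case: (g s).
  apply: is_derive_eq (is_deriveD (is_deriveM f1 g2) (is_deriveM f2 g1)) _.
  rewrite /GRing.scale /=.
  by case: d {f1 f2} => ? ?; case: e {g1 g2} => ? ?; case: (f t) => ? ?;
     case: (g t) => ? ? /=; ring.
Qed.

Lemma cderiveX f t d n : cderive f t d ->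
  cderive (fun s => f s ^+ n.+1) t (n.+1%:R * f t ^+ n * d).
Proof.
move=> fd; elim: n => [|n IH].
  by rewrite mulr1 mul1r.
under eq_fun do rewrite exprS.
have := cderiveM fd IH; congr cderive.
by rewrite [in RHS]mulrSr exprS; ring.
Qed.

Lemma cderive_sum (f : nat -> R -> C) t (d : nat -> C) n :
  (forall i, cderive (f i) t (d i)) ->
  cderive (fun s => \sum_(i < n) f i s) t (\sum_(i < n) d i).
Proof.
move=> fd; elim: n => [|n IH].
  by under eq_fun do rewrite big_ord0; rewrite big_ord0; exact: cderive_cst.
under eq_fun do rewrite big_ord_recr /=.
by rewrite big_ord_recr /=; exact: cderiveD.
Qed.

Lemma cderive_sqmod f t d : cderive f t d ->
  is_derive t 1 (fun s => sqmod (f s))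
    (2 * (complex.Re (f t) * complex.Re d + complex.Im (f t) * complex.Im d)).
Proof.
move=> [f1 f2].
have -> : (fun s => sqmod (f s)) =
  (fun s => complex.Re (f s)) * (fun s => complex.Re (f s)) +
  (fun s => complex.Im (f s)) * (fun s => complex.Im (f s)).
  by apply/funext => s; rewrite !fctE /sqmod !expr2.
apply: is_derive_eq (is_deriveD (is_deriveM f1 f1) (is_deriveM f2 f2)) _.
by rewrite /GRing.scale /=; ring.
Qed.

Lemma is_derive_inv (u : R -> R) t du : u t != 0 -> is_derive t 1 u du ->
  is_derive t 1 (fun s => (u s)^-1) (- (u t) ^- 2 * du).
Proof.
move=> u0 hu; apply: DeriveDef.
  by apply: derivableV => //; exact: ex_derive.
by rewrite deriveV // derive_val.
Qed.

Lemma cderiveV f t d : f t != 0 -> cderive f t d ->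
  cderive (fun s => (f s)^-1) t (- d / f t / f t).
Proof.
move=> f0 fd; have h0 := cderive_sqmod fd; case: (fd) => f1 f2.
have s0 : sqmod (f t) != 0 by rewrite sqmod_eq0.
have h := @is_derive_inv (fun s => sqmod (f s)) t _ s0 h0; split.
- have -> : (fun s => complex.Re (f s)^-1) =
    (fun s => complex.Re (f s)) * (fun s => (sqmod (f s))^-1).
    by apply/funext => s; rewrite !fctE; case: (f s).
  apply: is_derive_eq (is_deriveM f1 h) _; rewrite /GRing.scale /=.
  case: d {fd f1 f2 h h0} => d1 d2; move: f0 s0; case: (f t) => a b.
  by rewrite /sqmod /= => _ s0; field.
- have -> : (fun s => complex.Im (f s)^-1) =
    - (fun s => complex.Im (f s)) * (fun s => (sqmod (f s))^-1).
    by apply/funext => s; rewrite !fctE; case: (f s) => a b /=; rewrite mulNr.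
  apply: is_derive_eq (is_deriveM (is_deriveN f2) h) _.
  rewrite !fctE /GRing.scale /=.
  case: d {fd f1 f2 h h0} => d1 d2; move: f0 s0; case: (f t) => a b.
  by rewrite /sqmod /= => _ s0; field.
Qed.

Lemma is_derive_ln_sqmod f t d : f t != 0 -> cderive f t d ->
  is_derive t 1 (fun s => ln (sqmod (f s))) (2 * complex.Re (d / f t)).
Proof.
move=> f0 fd; have h := cderive_sqmod fd.
have s0 : 0 < sqmod (f t) by rewrite lt0r sqmod_eq0 f0 sqmod_ge0.
have := @is_derive1_comp R (@ln R) (fun s => sqmod (f s)) t _ _ (is_derive1_ln s0) h.
rewrite /comp => hh; apply: is_derive_eq hh _.
case: d {fd h} => d1 d2; move: f0 s0; case: (f t) => a b.
by rewrite /sqmod /= => _ s0; field; rewrite gt_eqF.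
Qed.

Lemma is_derive_arg f t d : 0 < complex.Re (f t) -> cderive f t d ->
  is_derive t 1 (fun s => arg (f s)) (complex.Im (d / f t)).
Proof.
move=> f0 [f1 f2].
have r0 : complex.Re (f t) != 0 by rewrite gt_eqF.
have h := is_deriveM f2 (@is_derive_inv (fun s => complex.Re (f s)) t _ r0 f1).
have := @is_derive1_comp R (@atan R) (fun s => complex.Im (f s) / complex.Re (f s)) t _ _ (is_derive1_atan _) h.
rewrite /comp => hh; apply: is_derive_eq hh _.
rewrite /GRing.scale /=.
case: d {h f1 f2} => d1 d2; move: f0 r0; case: (f t) => a b /= a0 r0.
field; rewrite r0 /=; have := sqr_ge0 b; nra.
Qed.

Lemma derive_le (u : R -> R) (du : R -> R) (M : R) :
  (forall t, 0 <= t <= 1 -> is_derive t 1 u (du t)) ->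
  (forall t, 0 <= t <= 1 -> `|du t| <= M) -> `|u 1 - u 0| <= M.
Proof.
move=> hu hM.
have [||c] := @MVT_segment R u du 0 1 ler01.
- move=> x; rewrite in_itv /= => /andP[x0 x1]; apply: hu.
  by rewrite !ltW.
- apply: derivable_within_continuous => x; rewrite in_itv /= => xi.
  by apply: ex_derive; exact: hu.
by rewrite in_itv /= subr0 mulr1 => ci ->; exact: hM.
Qed.

(** The Taylor polynomial of $-\log(1-u)$ at 0. *)
Definition log_taylor n (u : C) : C := \sum_(i < n) u ^+ i.+1 / i.+1%:R.

Lemma natC_neq0 n : (n.+1%:R : C) != 0.
Proof. by rewrite pnatr_eq0. Qed.

Lemma geom_remainder n (u : C) : u != 1 ->
  (1 - u)^-1 - \sum_(i < n) u ^+ i = u ^+ n / (1 - u).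
Proof.
move=> u1; have u1' : 1 - u != 0 by rewrite subr_eq0 eq_sym.
apply: (mulIf u1'); rewrite mulrBl mulVf // mulfVK //.
have -> : (\sum_(i < n) u ^+ i) * (1 - u) = - ((u - 1) * \sum_(i < n) u ^+ i) by ring.
by rewrite -subrX1; ring.
Qed.

Lemma cabs_1B_ge (u : C) : 1 - cabs u <= cabs (1 - u).
Proof.
by have := cabsD (1 - u) u; rewrite subrK cabs1 lerBlDr.
Qed.

(** Along the segment the remainder of $\log(1-u)$ has derivative $-d\,u^n/(1-u)$, by the geometric
    series. The factor [cabs d] is the point: a bound that is linear in the distance compensates the
    pole of the conjugation kernel. *)
Lemma log_taylor_lip n (r : R) (p d : C) : 0 <= r < 1 ->
  (forall t : R, 0 <= t <= 1 -> cabs (p + real_complex R t * d) <= r) ->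
  `|(ln (sqmod (1 - (p + d))) / 2 + complex.Re (log_taylor n (p + d))) -
    (ln (sqmod (1 - p)) / 2 + complex.Re (log_taylor n p))|
     <= cabs d * r ^+ n / (1 - r) /\
  `|(arg (1 - (p + d)) + complex.Im (log_taylor n (p + d))) -
    (arg (1 - p) + complex.Im (log_taylor n p))|
     <= cabs d * r ^+ n / (1 - r).
Proof.
move=> /andP[r0 r1] hr.
pose f s : C := p + real_complex R s * d.
have fd t : cderive f t d.
  have := cderiveD (cderive_cst p t) (cderiveM (cderive_real t) (cderive_cst d t)).
  by congr cderive; ring.
have gd t : cderive (fun s => 1 - f s) t (- d).
  have := cderiveD (cderive_cst 1 t) (cderiveM (cderive_cst (-1) t) (fd t)).
  congr cderive; first by apply/funext => s; rewrite mulN1r.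
  by ring.
have td t : cderive (fun s => log_taylor n (f s)) t (\sum_(i < n) f t ^+ i * d).
  apply: (@cderive_sum (fun i s => f s ^+ i.+1 / i.+1%:R) t (fun i => f t ^+ i * d)).
  move=> i.
  have := cderiveM (cderiveX i (fd t)) (cderive_cst (i.+1%:R)^-1 t).
  congr cderive; have := natC_neq0 i; set N : C := i.+1%:R => N0.
  by rewrite mulr0 addr0; field.
have f1 t : 0 <= t <= 1 -> cabs (f t) < 1.
  by move=> /hr h; apply: le_lt_trans r1.
have fRe t : 0 <= t <= 1 -> 0 < complex.Re (1 - f t).
  by move=> /f1 h; apply: Re_1D_gt0; rewrite cabsN.
have bd t : 0 <= t <= 1 ->
    cabs (- d / (1 - f t) + \sum_(i < n) f t ^+ i * d) <=
    cabs d * r ^+ n / (1 - r).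
  move=> ti; have h1 := f1 _ ti.
  have n1 : f t != 1.
    by apply: contraTneq h1 => ->; rewrite cabs1 ltxx.
  rewrite -mulr_suml.
  have -> : - d / (1 - f t) + (\sum_(i < n) f t ^+ i) * d =
    - d * ((1 - f t)^-1 - \sum_(i < n) f t ^+ i) by ring.
  rewrite geom_remainder // !cabsM cabsN cabsV cabsX mulrA.
  apply: ler_pM.
  - by rewrite mulr_ge0 ?exprn_ge0 ?cabs_ge0.
  - by rewrite invr_ge0 cabs_ge0.
  - by rewrite ler_wpM2l ?cabs_ge0 // lerXn2r ?nnegrE ?cabs_ge0 // hr.
  - rewrite lef_pV2 ?posrE ?subr_gt0 //.
      by apply: le_trans (cabs_1B_ge _); rewrite lerB // hr.
    by apply: lt_le_trans (cabs_1B_ge _); rewrite subr_gt0.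
have e1 : f 1 = p + d by rewrite /f mul1r.
have e0 : f 0 = p by rewrite /f mul0r addr0.
split.
- pose u s := ln (sqmod (1 - f s)) / 2 + complex.Re (log_taylor n (f s)).
  pose du t := complex.Re (- d / (1 - f t)  + \sum_(i < n) f t ^+ i * d).
  have := @derive_le u du; rewrite /u e1 e0; apply.
  + move=> t ti; have [td1 _] := td t.
    have h := is_derive_ln_sqmod (Re_gt0_neq0 (fRe _ ti)) (gd t).
    have h2 := is_deriveD (is_deriveM h (is_derive_cst (2^-1 : R) t 1)) td1.
    apply: is_derive_eq h2 _; rewrite /du /GRing.scale /=.
    by case: (_ / _) => x1 x2; case: (\sum_(i < n) _) => x3 x4 /=; field.
  + by move=> t ti; apply: le_trans (Re_cabs _) _; exact: bd.
- pose u s := arg (1 - f s) + complex.Im (log_taylor n (f s)).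
  pose du t := complex.Im (- d / (1 - f t)  + \sum_(i < n) f t ^+ i * d).
  have := @derive_le u du; rewrite /u e1 e0; apply.
  + move=> t ti; have [_ td1] := td t.
    have h := is_derive_arg (fRe _ ti) (gd t).
    apply: is_derive_eq (is_deriveD h td1) _; rewrite /du.
    by case: (_ / _) => x1 x2; case: (\sum_(i < n) _) => x3 x4 /=.
  + by move=> t ti; apply: le_trans (Im_cabs _) _; exact: bd.
Qed.

Lemma arg1 : arg (1 : C) = 0.
Proof. by rewrite /arg /= mul0r atan0. Qed.

Lemma arg_taylor n (v : C) : cabs v < 1 ->
  `|arg (1 - v) + complex.Im (log_taylor n v)| <=
  cabs v * cabs v ^+ n / (1 - cabs v).
Proof.
move=> v1; have [||_] := @log_taylor_lip n (cabs v) 0 v.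
- by rewrite cabs_ge0.
- move=> t /andP[t0 t1]; rewrite add0r cabsM cabs_real ger0_norm //.
  by rewrite ler_piMl ?cabs_ge0.
- rewrite add0r subr0 arg1 add0r.
  have -> : log_taylor n (0 : C) = 0.
    by rewrite /log_taylor big1 // => i _; rewrite expr0n mul0r.
  by rewrite subr0.
Qed.

Lemma arg_le (v : C) : cabs v <= 2^-1 -> `|arg (1 + v)| <= 2 * cabs v.
Proof.
move=> v2; have := @arg_taylor 0 (- v); rewrite cabsN opprK /log_taylor big_ord0.
rewrite /= addr0 mulr1 => h; have v0 := cabs_ge0 v.
apply: le_trans (h _) _; first by lra.
by rewrite ler_pdivrMr; nra.
Qed.

Lemma arg_Im_le (v : C) : cabs v <= 2^-1 ->
  `|arg (1 + v) - complex.Im v| <= 2 * cabs v ^+ 2.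
Proof.
move=> v2; have := @arg_taylor 1 (- v); rewrite cabsN opprK /log_taylor big_ord1.
rewrite divr1 !expr1 => h; have v0 := cabs_ge0 v.
have -> : complex.Im v = - complex.Im (- v) by case: v {h v2 v0} => a b /=; rewrite opprK.
rewrite opprK; apply: le_trans (h _) _; first by lra.
by rewrite ler_pdivrMr; nra.
Qed.

End ComplexPaths.

(** * Differentiable arguments along a path and their uniqueness *)

Section Lifts.
Variable R : realType.
Local Notation C := R[i].

Lemma argP (z : C) : 0 < complex.Re z ->
  z = real_complex R (cabs z) * expi (arg z).
Proof.
case: z => a b /= a0; rewrite /arg /expi /cabs /sqmod /=.
set r := Num.sqrt _; set th := atan _.
have c0 : 0 < cos th.
  by apply: cos_gt0_pihalf; rewrite atan_gtNpi2 atan_ltpi2.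
have ht : tan th = b / a by rewrite /th atanK.
have sE : sin th = b / a * cos th by rewrite -ht /tan divfK // gt_eqF.
have rE : r * cos th = a.
  have r0 : 0 <= r by exact: sqrtr_ge0.
  have r2 : r ^+ 2 = a ^+ 2 + b ^+ 2 by rewrite sqr_sqrtr // addr_ge0 ?sqr_ge0.
  have := cos2Dsin2 th; rewrite sE => h.
  apply/eqP; rewrite -(@eqrXn2 _ 2) //; last exact: ltW.
    2: by rewrite mulr_ge0 // ltW.
  have e2 : cos th ^+ 2 * r ^+ 2 = a ^+ 2 * (cos th ^+ 2 + (b / a * cos th) ^+ 2).
    by rewrite r2; field; rewrite gt_eqF.
  by rewrite exprMn mulrC e2 h mulr1.
simpc; congr Complex; first by rewrite rE.
by rewrite sE mulrCA rE divfK // gt_eqF.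
Qed.

(** A differentiable choice of argument on the unit interval. The modulus is left free, so positive
    factors can be ignored. *)
Definition polar (f : R -> C) (th : R -> R) : Prop :=
  forall t, 0 <= t <= 1 -> derivable th t 1 /\
    exists2 r : R, 0 < r & f t = real_complex R r * expi (th t).

Lemma polarM f g th et : polar f th -> polar g et ->
  polar (fun t => f t * g t) (fun t => th t + et t).
Proof.
move=> hf hg t ti; have [df [r r0 fE]] := hf t ti.
have [dg [s s0 gE]] := hg t ti; split; first exact: derivableD.
exists (r * s); first exact: mulr_gt0.
by rewrite fE gE expiD rmorphM /=; ring.
Qed.

Lemma polar_arg f : (forall t, 0 <= t <= 1 -> 0 < complex.Re (f t)) ->
  (forall t, 0 <= t <= 1 -> exists d, cderive f t d) ->
  polar f (fun t => arg (f t)).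
Proof.
move=> f0 fd t ti; have [d hd] := fd t ti; split.
  by have := is_derive_arg (f0 t ti) hd => h; exact: ex_derive.
exists (cabs (f t)); last by apply: argP; exact: f0.
by rewrite cabs_gt0 Re_gt0_neq0 // f0.
Qed.

Lemma polar_prod n (f : nat -> R -> C) (th : nat -> R -> R) :
  (forall i, (i < n)%N -> polar (f i) (th i)) ->
  polar (fun t => \prod_(i < n) f i t) (fun t => \sum_(i < n) th i t).
Proof.
elim: n => [|n IH] h.
  move=> t _; split.
    by under eq_fun do rewrite big_ord0; exact: derivable_cst.
  by exists 1; rewrite ?ltr01 // !big_ord0 expi0 mulr1.
rewrite (_ : (fun t => _) = fun t => (\prod_(i < n) f i t) * f n t); last first.
  by apply/funext => t; rewrite big_ord_recr.
rewrite [X in polar _ X](_ : _ = fun t => (\sum_(i < n) th i t) + th n t); last first.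
  by apply/funext => t; rewrite big_ord_recr.
apply: polarM; last exact: h.
by apply: IH => i lin; apply: h; exact: ltnW.
Qed.

(** A continuous function with values in $2\pi\mathbb{Z}$ is constant: otherwise [th] takes a value
    $\pm m$ with $0<m\le\pi/2$, where the cosine is not 1. *)
Lemma expi_eq1_lift (th : R -> R) :
  (forall t, 0 <= t <= 1 -> derivable th t 1) ->
  (forall t, 0 <= t <= 1 -> expi (th t) = 1) -> th 0 = 0 -> th 1 = 0.
Proof.
move=> dth h th0; apply/eqP; apply/negPn/negP => th1.
have cth : {within `[0, 1], continuous th}.
  by apply: derivable_within_continuous => x; rewrite in_itv /= => /dth.
have m0 : 0 < Num.min `|th 1| (pi / 2) :> R.
  by rewrite lt_min normr_gt0 th1 divr_gt0 ?pi_gt0.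
have m1 : Num.min `|th 1| (pi / 2) <= `|th 1| by rewrite ge_min lexx.
have m2 : Num.min `|th 1| (pi / 2) <= pi / 2 :> R by rewrite ge_min lexx orbT.
move: (Num.min _ _) m0 m1 m2 => m m0 m1 m2.
pose v := if 0 < th 1 then m else - m.
have hv : Num.min (th 0) (th 1) <= v <= Num.max (th 0) (th 1).
  rewrite th0 /v ge_min le_max; case: ifP => s0.
  - by rewrite (ltW m0) -{2}(gtr0_norm s0) m1 orbT.
  - have s1 : th 1 < 0 by rewrite lt_neqAle th1 leNgt s0.
    by move: m1; rewrite ltr0_norm // lerNr oppr_le0 (ltW m0) => ->; rewrite orbT.
have [c ci cE] := IVT ler01 cth hv.
have {}ci : 0 <= c <= 1 by move: ci; rewrite in_itv.
have := h c ci; rewrite /expi => -[] + _; rewrite cE /v => hc.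
have {hc} : cos m = 1 by rewrite -hc; case: ifP; rewrite ?cosN.
rewrite -[RHS]cos0 => /cos_inj h2; have := m0; rewrite h2 ?ltxx //.
- by rewrite in_itv /= (ltW m0) /=; have := pi_ge0 R; lra.
- by rewrite in_itv /= lexx pi_ge0.
Qed.

Lemma polar_uniq f th et : polar f th -> polar f et -> th 0 = et 0 ->
  th 1 = et 1.
Proof.
move=> hf hg h0; apply/eqP; rewrite -subr_eq0; apply/eqP.
apply: (@expi_eq1_lift (fun t => th t - et t)); last by rewrite h0 subrr.
- move=> t ti; have [d1 _] := hf t ti; have [d2 _] := hg t ti.
  exact: derivableB.
- move=> t ti; have [_ [r r0 fE]] := hf t ti; have [_ [s s0 gE]] := hg t ti.
  have rs : r = s.
    have := congr1 (@cabs R) fE; rewrite gE !cabsM !cabs_expi !mulr1 !cabs_real.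
    by rewrite !gtr0_norm.
  rewrite expiD expiN; rewrite fE rs in gE.
  have s0' : real_complex R s != 0.
    by rewrite -cabs_eq0 cabs_real normr_eq0 gt_eqF.
  by rewrite (mulfI s0' gE) mulrC conj_unit ?sqmod_expi.
Qed.

End Lifts.

(** * The contribution of one block of constant coefficients *)

Section Blocks.
Variable R : realType.
Local Notation C := R[i].

Lemma Im_realMD (r : R) (x y : C) :
  complex.Im (real_complex R r * x + y) = r * complex.Im x + complex.Im y.
Proof. by case: x y => [a b] [c d] /=; ring. Qed.

Lemma cderive_chain (G : nat -> C) (z y : R -> C) t n :
  (forall m, cabs (G m) < 1) -> cabs (z t) <= 1 -> cabs (y t) <= 1 ->
  (exists d, cderive z t d) -> (exists d, cderive y t d) ->
  exists d, cderive (fun s => chain G (z s) (y s) n) t d.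
Proof.
move=> G1 z1 y1 [dz hz] hy; elim: n => [//|n [dc hc]] /=; eexists.
apply: cderiveM; first apply: cderiveM hz _.
  exact: cderiveD hc (cderive_cst _ _).
apply: cderiveV.
  exact/Re_gt0_neq0/chain_Re_gt0.
exact: cderiveD (cderive_cst _ _) (cderiveM (cderive_cst _ _) hc).
Qed.

(** All factors $1+G_m y_m$ stay in the right half-plane along the path, so the sum of their
    principal arguments has no jumps and is an argument of their product. *)
Lemma polar_chain (G : nat -> C) (z y : R -> C) n :
  (forall m, cabs (G m) < 1) ->
  (forall t, 0 <= t <= 1 -> cabs (z t) <= 1) ->
  (forall t, 0 <= t <= 1 -> cabs (y t) <= 1) ->
  (forall t, 0 <= t <= 1 -> exists d, cderive z t d) ->
  (forall t, 0 <= t <= 1 -> exists d, cderive y t d) ->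
  polar (fun t => (lin G (z t) (1, y t) n).1)
        (fun t => chain_arg G (z t) (y t) n).
Proof.
move=> G1 z1 y1 dz dy.
pose f m t := 1 + G m * chain G (z t) (y t) m.
have h : polar (fun t => \prod_(m < n) f m t) (fun t => \sum_(m < n) arg (f m t)).
  apply: (@polar_prod _ n f (fun m t => arg (f m t))) => m _; apply: polar_arg.
  - by move=> t ti; apply: chain_Re_gt0; [|exact: z1|exact: y1].
  - move=> t ti; have [d hd] := cderive_chain m G1 (z1 t ti) (y1 t ti) (dz t ti) (dy t ti).
    eexists; exact: cderiveD (cderive_cst _ _) (cderiveM (cderive_cst _ _) hd).
move=> t ti; have [h1 [r r0 hr]] := h t ti; split; first exact: h1.
by exists r => //; have [-> _] := linE n G1 (z1 t ti) (y1 t ti).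
Qed.

(* Homotopy in the initial value: t |-> t y. *)
Lemma chain_arg_start (G : nat -> C) z y n : (forall m, cabs (G m) < 1) ->
  sqmod z = 1 -> cabs y <= 1 ->
  exists2 v, cabs v = cabs y * cabs (chain G z 0 n) &
    chain_arg G z y n = chain_arg G z 0 n + arg (1 + v).
Proof.
move=> G1 z1 y1; have z1' : cabs z <= 1 by rewrite cabs_eq1.
have o1 : cabs (0 : C) <= 1 by rewrite cabs0 ler01.
set al := (lin G z (1, 0) n).1; set be := (lin G z (0, 1) n).1.
have [e1 _ _] := lin_unitary G n z1.
have al0 : al != 0.
  rewrite -sqmod_eq0 gt_eqF //; have := defect_gt0 n G1; rewrite -e1 subr_gt0.
  exact/le_lt_trans/sqmod_ge0.
(* By linearity the initial value [y] multiplies [al] by [1 + be / al * y]; the equality of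
   off-diagonal moduli identifies the size of this perturbation. *)
have rhoE : cabs (be / al) = cabs (chain G z 0 n).
  have [_ h2] := linE n G1 z1' o1.
  have hb : cabs be = cabs (chain G z 0 n) * cabs al.
    by rewrite -cabsM /al -h2 /cabs lin_sqmod_swap.
  by rewrite cabsM cabsV hb mulfK // cabs_eq0.
have rho1 : cabs (be / al) < 1.
  rewrite cabsM cabsV ltr_pdivrMr ?cabs_gt0 // mul1r /cabs ltr_sqrt; last first.
    by rewrite lt0r sqmod_eq0 al0 sqmod_ge0.
  by rewrite lin_sqmod_swap // -subr_gt0 e1 defect_gt0.
exists (be / al * y); first by rewrite cabsM rhoE mulrC.
pose yt (t : R) := real_complex R t * y.
have yt1 t : 0 <= t <= 1 -> cabs (yt t) <= 1.
  move=> /andP[t0 t1]; rewrite cabsM cabs_real ger0_norm //.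
  by rewrite -[1]mulr1 ler_pM ?cabs_ge0.
have dyt t : exists d, cderive yt t d.
  eexists; exact: cderiveM (cderive_real _) (cderive_cst _ _).
have h1 := @polar_chain G (fun=> z) yt n G1 (fun _ _ => z1') yt1
  (fun t _ => ex_intro _ _ (cderive_cst z t)) (fun t _ => dyt t).
have h2 : polar (fun=> al) (fun=> chain_arg G z 0 n).
  move=> t ti; have ti0 : 0 <= (0 : R) <= 1 by rewrite lexx ler01.
  have [_ [r r0 hr]] := h1 0 ti0; split; first exact: derivable_cst.
  by exists r => //; move: hr; rewrite /yt mul0r.
have h3 : polar (fun t => 1 + be / al * yt t) (fun t => arg (1 + be / al * yt t)).
  apply: polar_arg.
  - by move=> t ti; apply: Re_1D_gt0M => //; exact: yt1.
  - move=> t ti; have [d hd] := dyt t.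
    eexists; exact: cderiveD (cderive_cst _ _) (cderiveM (cderive_cst _ _) hd).
have h4 : polar (fun t => (lin G z (1, yt t) n).1)
  (fun t => chain_arg G z 0 n + arg (1 + be / al * yt t)).
  have := polarM h2 h3; congr polar; apply/funext => t.
  have [-> _] := lin_linear G z (yt t) n; rewrite -/al -/be.
  by field.
(* Both are arguments of the same path; at time 0 they agree because the initial value is 0 and
   [arg 1 = 0]. *)
have := polar_uniq h1 h4; rewrite /yt mul0r mulr0 addr0 arg1 addr0 mul1r.
exact.
Qed.

(** For small [e] the recursion perturbs the affine map $y\mapsto wy+we$, whose orbit from 0 circles
    around the fixed point $ew/(1-w)$. The bound on $48De^2$ keeps the accumulated nonlinear error
    below the size of that fixed point, so that $D$ steps give $D$ times its contribution up to a
    bounded boundary term. *)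
Lemma block_estimate (e : R) D (w y : C) : 0 < e -> e < 1 -> sqmod w = 1 ->
  w != 1 -> 48 * D%:R * e ^+ 2 <= cabs (1 - w) -> e <= cabs (1 - w) / 8 ->
  cabs y <= 1 ->
  `|chain_arg (fun=> real_complex R e) w y D -
    D%:R * e ^+ 2 * complex.Im (w / (1 - w))| <= 10 * e / cabs (1 - w).
Proof.
move=> e0 e1 w1 wn1; set k := cabs (1 - w) => hD he y1.
have w1' : cabs w = 1 by rewrite cabs_eq1.
have sw0 : 1 - w != 0 by rewrite subr_eq0 eq_sym.
have k0 : 0 < k by rewrite cabs_gt0.
have k2 : k <= 2.
  by have := cabsD 1 (- w); rewrite cabsN w1' cabs1.
set E := real_complex R e; have EJ : conjc E = E by rewrite /E conjc_real.
have Ee : cabs E = e by rewrite cabs_real gtr0_norm.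
have E2 : real_complex R (e ^+ 2) = E ^+ 2 by rewrite rmorphXn.
clearbody E.
have E1 : cabs E < 1 by rewrite Ee.
have [v vE ->] := @chain_arg_start (fun=> E) w y D (fun=> E1) w1 y1.
pose Y m := chain (fun=> E) w 0 m.
pose err m := - w * (Y m + E) * (E * Y m) / (1 + E * Y m).
have YS m : Y m.+1 = w * Y m + w * E + err m.
  rewrite -[Y m.+1]/(w * (Y m + conjc E) / (1 + E * Y m)) EJ /err.
  have h : 1 + E * Y m != 0.
    apply/Re_gt0_neq0/Re_1D_gt0M; rewrite ?Ee //; apply: chain_le1 => //.
      by rewrite w1'.
    by rewrite cabs0 ler01.
  by field.
pose q := e / k; have q0 : 0 < q by rewrite divr_gt0.
have q8 : q <= 8^-1 by rewrite ler_pdivrMr // mulrC.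
have eq' : e = q * k by rewrite divfK // gt_eqF.
have e2q : e <= 2 * q by rewrite {1}eq'; nra.
(* The constant is $6\cdot4\cdot2$: $|Y+E|\le 4q+2q$, $|EY|\le 4eq$, and the denominator is at least
   $1/2$. *)
have errle m : cabs (Y m) <= 4 * q -> cabs (err m) <= 48 * e * q ^+ 2.
  move=> hY; rewrite /err !cabsM cabsN w1' mul1r cabsV Ee.
  have hd : 2^-1 <= cabs (1 + E * Y m).
    have := cabs_1B_ge (- (E * Y m)); rewrite opprK cabsN cabsM Ee => h.
    apply: le_trans h; have := cabs_ge0 (Y m); nra.
  have hn : cabs (Y m + E) <= 6 * q.
    by apply: le_trans (cabsD _ _) _; rewrite Ee; lra.
  rewrite ler_pdivrMr; last by lra.
  have c0 := cabs_ge0 (Y m); have c1 := cabs_ge0 (Y m + E).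
  have h1 : cabs (Y m + E) * (e * cabs (Y m)) <= 6 * q * (e * (4 * q)).
    by apply: ler_pM => //; [rewrite mulr_ge0 // ltW|rewrite ler_wpM2l // ltW].
  apply: le_trans h1 _.
  have h2 : 48 * e * q ^+ 2 * 2^-1 <= 48 * e * q ^+ 2 * cabs (1 + E * Y m).
    by rewrite ler_wpM2l // mulr_ge0 ?sqr_ge0 // mulr_ge0 // ltW.
  by apply: le_trans h2; rewrite le_eqVlt; apply/orP; left; apply/eqP; field.
pose f := E * w / (1 - w).
have fq : cabs f = q by rewrite /f !cabsM cabsV Ee w1' mulr1.
have De : 48 * D%:R * e * q <= 1.
  rewrite /q mulrA ler_pdivrMr // mul1r; apply: le_trans hD.
  by rewrite le_eqVlt; apply/orP; left; apply/eqP; ring.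
(* Bootstrap: multiplication by [w] preserves the distance to [f], which is [q] at the start, and
   all [D] errors together add at most another [q]. Hence $|Y_m|\le 3q$, inside the range that
   [errle] requires. *)
have dev m : (m <= D)%N ->
  cabs (Y m - f) <= q + m%:R * (48 * e * q ^+ 2) /\ cabs (Y m) <= 4 * q.
  elim: m => [_|m IH mD].
    by rewrite /Y /= sub0r cabsN fq cabs0 mul0r addr0; split=> //; lra.
  have [IH1 IH2] := IH (ltnW mD); have he' := errle m IH2.
  have h1 : cabs (Y m.+1 - f) <= q + m.+1%:R * (48 * e * q ^+ 2).
    have -> : Y m.+1 - f = w * (Y m - f) + err m.
      by rewrite YS /f; field.
    apply: le_trans (cabsD _ _) _; rewrite cabsM w1' mul1r.
    by rewrite -[m.+1%:R]natr1; lra.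
  split=> //.
  have h2 : m.+1%:R * (48 * e * q ^+ 2) <= q.
    have h3 : m.+1%:R * (48 * e * q ^+ 2) <= D%:R * (48 * e * q ^+ 2).
      by rewrite ler_wpM2r ?ler_nat // mulr_ge0 ?sqr_ge0 // mulr_ge0 // ltW.
    apply: le_trans h3 _.
    have -> : D%:R * (48 * e * q ^+ 2) = (48 * D%:R * e * q) * q by ring.
    by rewrite ler_piMl // ltW.
  have -> : Y m.+1 = (Y m.+1 - f) + f by rewrite subrK.
  by apply: le_trans (cabsD _ _) _; rewrite fq; lra.
(* Summing [YS] telescopes: besides the main term, only the errors and one boundary value remain. *)
have sumE n : (1 - w) * \sum_(m < n) Y m = n%:R * (E * w) + \sum_(m < n) err m - Y n.
  elim: n => [|n IH]; first by rewrite !big_ord0 /Y /=; ring.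
  rewrite !big_ord_recr /= mulrDr IH YS -[n.+1%:R]natr1.
  by ring.
have dD m : (m < D)%N -> cabs (Y m) <= 4 * q by move=> /ltnW /dev [].
have mainE : \sum_(m < D) complex.Im (E * Y m) =
    D%:R * e ^+ 2 * complex.Im (w / (1 - w)) +
    complex.Im (E * (\sum_(m < D) err m - Y D) / (1 - w)).
  have -> : \sum_(m < D) complex.Im (E * Y m) = complex.Im (E * \sum_(m < D) Y m).
    rewrite mulr_sumr; elim: (D) => [|n IH]; first by rewrite !big_ord0.
    by rewrite !big_ord_recr /= IH; case: (\sum_(i < n) _) => ? ?; case: (_ * _).
  have -> : E * (\sum_(m < D) Y m) =
      real_complex R (D%:R * e ^+ 2) * (w / (1 - w)) +
      E * (\sum_(m < D) err m - Y D) / (1 - w).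
    have -> : real_complex R (D%:R * e ^+ 2) = D%:R * E ^+ 2.
      by rewrite rmorphM /= rmorph_nat E2.
    apply: (mulfI sw0); rewrite mulrCA sumE.
    by field.
  by rewrite Im_realMD.
set T := \sum_(m < D) err m - Y D.
have Tle : cabs (E * T / (1 - w)) <= q * (5 * q).
  rewrite !cabsM cabsV Ee -/k mulrAC -/q ler_wpM2l //; first exact: ltW.
  apply: le_trans (cabsD _ _) _; rewrite cabsN.
  have h1 : cabs (\sum_(m < D) err m) <= D%:R * (48 * e * q ^+ 2).
    apply: le_trans (cabs_sum _ _) _.
    have h (m : 'I_D) : true -> cabs (err m) <= 48 * e * q ^+ 2.
      by move=> _; exact/errle/dD.
    apply: le_trans (ler_sum _ h) _.
    by rewrite sumr_const card_ord -[leLHS]mulr_natl.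
  have h2 : D%:R * (48 * e * q ^+ 2) <= q.
    have -> : D%:R * (48 * e * q ^+ 2) = (48 * D%:R * e * q) * q by ring.
    by rewrite ler_piMl // ltW.
  by have [_] := dev D (leqnn D); lra.
have argle : `|chain_arg (fun=> E) w 0 D - \sum_(m < D) complex.Im (E * Y m)|
    <= 2 * q ^+ 2.
  rewrite /chain_arg -sumrB; apply: le_trans (ler_norm_sum _ _ _) _.
  have h (m : 'I_D) : true ->
      `|arg (1 + E * chain (fun=> E) w 0 m) - complex.Im (E * Y m)|
      <= 32 * e ^+ 2 * q ^+ 2.
    move=> _; have hY := dD m (ltn_ord m); have c0 := cabs_ge0 (Y m).
    have hv : cabs (E * Y m) <= e * (4 * q).
      by rewrite cabsM Ee ler_wpM2l // ltW.
    have hv2 : cabs (E * Y m) ^+ 2 <= (e * (4 * q)) ^+ 2.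
      have ? : 0 <= e * (4 * q) by nra.
      by apply: lerXn2r hv; rewrite nnegrE ?cabs_ge0.
    apply: le_trans (arg_Im_le _) _; first by apply: le_trans hv _; nra.
    apply: (@le_trans _ _ (2 * (e * (4 * q)) ^+ 2)); first by rewrite ler_wpM2l.
    by rewrite le_eqVlt; apply/orP; left; apply/eqP; ring.
  apply: le_trans (ler_sum _ h) _.
  rewrite sumr_const card_ord -[leLHS]mulr_natl.
  have : 48 * D%:R * e ^+ 2 <= 2 by apply: le_trans hD _.
  have := sqr_ge0 q; set q2 := q ^+ 2; set e2 := e ^+ 2; set d : R := D%:R.
  move=> h0 h1; have : 0 <= (2 - 48 * d * e2) * q2 by rewrite mulr_ge0 // subr_ge0.
  by lra.
have vle : `|arg (1 + v)| <= 8 * q.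
  have hv : cabs v <= 4 * q.
    rewrite vE -/(Y D); have [_ hY] := dev D (leqnn D); apply: le_trans hY.
    by rewrite ler_piMl ?cabs_ge0.
  by apply: le_trans (arg_le _) _; lra.
have Tim := le_trans (Im_cabs _) Tle.
have -> : 10 * e / k = 10 * q by rewrite /q mulrA.
rewrite mainE in argle.
move: argle vle Tim; rewrite !ler_norml => /andP[? ?] /andP[? ?] /andP[? ?].
have ? : q ^+ 2 <= q * 8^-1 by rewrite expr2 ler_wpM2l // ltW.
(* The errors are $8q$ for the initial value, $5q^2$ for the remainder of the sum and $2q^2$ for
   replacing arguments by imaginary parts; $q\le1/8$ brings the total below $10q$. *)
by apply/andP; split; lra.
Qed.

End Blocks.

(** * Integrals over the circle with a symmetric arc removed *)

Section PrincipalValue.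
Variable R : realType.
Local Notation C := R[i].
Local Notation mu := (@lebesgue_measure R).

Lemma derivable_cont (f : R -> R) t : derivable f t 1 -> {for t, continuous f}.
Proof. by move=> /derivable1_diffP /differentiable_continuous. Qed.

Lemma ftc_segment (f E : R -> R) (a b : R) : a < b ->
  (forall t, a <= t <= b -> {for t, continuous f}) ->
  (forall t, a <= t <= b -> is_derive t 1 E (f t)) ->
  \int[mu]_(t in `[a, b]) f t = E b - E a.
Proof.
move=> ab cf dE; rewrite /Rintegral (@continuous_FTC2 _ f E) //.
- apply: continuous_in_subspaceT => t; rewrite inE /= in_itv /= => ti.
  exact: cf.
- have cE t : a <= t <= b -> {for t, continuous E}.
    by move=> ti; apply: derivable_cont; have h := dE t ti; exact: ex_derive.
  split.
  + move=> t; rewrite in_itv /= => /andP[t1 t2].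
    have ti : a <= t <= b by rewrite !ltW.
    by have h := dE t ti; exact: ex_derive.
  + by apply: cvg_at_right_filter; apply: cE; rewrite lexx ltW.
  + by apply: cvg_at_left_filter; apply: cE; rewrite lexx ltW.
- move=> t; rewrite in_itv /= => /andP[t1 t2].
  have ti : a <= t <= b by rewrite !ltW.
  by have h := dE t ti; rewrite derive1E derive_val.
Qed.

Lemma expi2pi (t : R) : expi (t + 2 * pi) = expi t.
Proof. by rewrite /expi mulr_natl cosD2pi sinD2pi. Qed.

Lemma sqmod_expiB (s t : R) : sqmod (expi s - expi t) = 2 - 2 * cos (s - t).
Proof.
rewrite /sqmod /= cosB; have := cos2Dsin2 s; have := cos2Dsin2 t.
move: (cos s) (sin s) (cos t) (sin t) => a b c d h1 h2.
transitivity ((a ^+ 2 + b ^+ 2) + (c ^+ 2 + d ^+ 2) - 2 * (a * c + b * d)).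
  by ring.
by rewrite h1 h2; ring.
Qed.

Lemma cos_le_cos (t d : R) : 0 <= t <= 2 * pi -> 0 < d <= pi ->
  (cos t <= cos d) = (d <= t <= 2 * pi - d).
Proof.
move=> /andP[t0 t2] /andP[d0 dpi]; have p0 := pi_gt0 R.
have di : d \in `[0, pi] by rewrite in_itv /= ltW.
have mono x : 0 <= x <= pi -> (cos x <= cos d) = (d <= x).
  by move=> xi; rewrite leNgt ltr_cos ?in_itv ?[RHS]leNgt.
have [tp|tp] := leP t pi.
  rewrite mono ?t0 //; case: (leP d t) => //= dt.
  by apply/esym; lra.
have -> : cos t = cos (2 * pi - t).
  by rewrite addrC mulr_natl cosD2pi cosN.
rewrite mono; last by apply/andP; split; lra.
by apply/idP/idP => [h|/andP[h1 h2]]; [apply/andP; split|]; lra.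
Qed.

Variable phi : R.
Hypotheses (phi_ge0 : 0 <= phi) (phi_lt : phi < 2 * pi).
Local Notation z := (expi phi).

Definition pv_dom (eps : R) : set R :=
  [set t : R | 0 <= t <= 2 * pi /\ eps <= cabs (expi t - z)].

(** Two shapes, because for $\phi=0$ the removed arc straddles the common end of the parameter
    interval. *)
Definition pv_shape (eps d : R) : Prop :=
  (0 < phi - d /\ phi + d < 2 * pi /\
     pv_dom eps = `[0, phi - d] `|` `[phi + d, 2 * pi]) \/
  (phi = 0 /\ d < 2 * pi - d /\ pv_dom eps = `[d, 2 * pi - d]%classic).

Lemma pv_dom_shape (eta : R) : 0 < eta -> exists2 e0 : R, 0 < e0 &
  forall eps, 0 < eps -> eps < e0 -> exists2 d : R, 0 < d < eta &
  pv_shape eps d.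
Proof.
move=> eta0; have p0 := pi_gt0 R; have p2 := pi_ge2 R.
(* The half-angle has to stay below the distance from $\phi$ to either end of the interval; at
   $\phi=0$ the distance to 0 is replaced by 1. *)
pose m := if phi == 0 then 1 else phi.
have m0 : 0 < m by rewrite /m; case: ifPn => // h; rewrite lt0r h.
pose et := Num.min (Num.min eta 1) (Num.min m (2 * pi - phi)).
have et0 : 0 < et by rewrite !lt_min eta0 ltr01 m0 subr_gt0 phi_lt.
have [et1 et2 et3 et4] : [/\ et <= eta, et <= 1, et <= m & et <= 2 * pi - phi].
  by rewrite /et; split; rewrite !ge_min lexx ?orbT.
have ei : et \in `[0, pi] by rewrite in_itv /= ltW //=; lra.
have cet : cos et < 1.
  by rewrite -cos0 ltr_cos // in_itv /= lexx ltW.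
exists (Num.sqrt (2 - 2 * cos et)); first by rewrite sqrtr_gt0; lra.
move=> eps eps0 epsl.
have eps2 : eps ^+ 2 < 2 - 2 * cos et.
  have : eps ^+ 2 < Num.sqrt (2 - 2 * cos et) ^+ 2.
    by rewrite ltr_pXn2r ?nnegrE ?sqrtr_ge0 ?ltW.
  by rewrite sqr_sqrtr //; lra.
(* A chord of length [eps] subtends the angle $d$ with $\mathrm{eps}^2=2-2\cos d$. *)
pose x := 1 - eps ^+ 2 / 2.
have e20 : 0 < eps ^+ 2 by rewrite exprn_gt0.
have xi : -1 <= x < 1.
  by rewrite /x; have := cos_geN1 et; move=> ?; apply/andP; split; lra.
have xi' : -1 <= x <= 1 by case/andP: xi => -> /ltW ->.
have dcos : cos (acos x) = x by rewrite acosK.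
have d0 := acos_gt0 xi; have dpi := acos_lepi xi'.
move: (acos x) dcos d0 dpi => d dcos d0 dpi.
have de : d < et.
  have : cos et < cos d by rewrite dcos /x; lra.
  by rewrite ltr_cos // in_itv /= ltW.
have domE t : (eps <= cabs (expi t - z)) = (cos (t - phi) <= cos d).
  have -> : (eps <= cabs (expi t - z)) = (eps ^+ 2 <= cabs (expi t - z) ^+ 2).
    by rewrite ler_pXn2r // nnegrE ?cabs_ge0 // (ltW eps0).
  by rewrite cabs_sq sqmod_expiB dcos /x; apply/idP/idP; lra.
exists d; first by rewrite d0 /=; lra.
have [ph0|ph0] := eqVneq phi 0.
  right; split=> //; split; first by lra.
  apply/seteqP; split=> t; rewrite /pv_dom /= domE ph0 subr0 in_itv /=.
    by move=> [ti]; rewrite cos_le_cos // d0 dpi.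
  move=> /andP[t1 t2]; have ti : 0 <= t <= 2 * pi by apply/andP; split; lra.
  by split=> //; rewrite cos_le_cos ?t1 ?d0.
left; have dph : d < phi.
  by move: et3; rewrite /m (negbTE ph0) => h; lra.
split; [by lra|split; first by lra].
have key t : 0 <= t <= 2 * pi -> (cos (t - phi) <= cos d) = (d <= `|t - phi|).
  move=> /andP[t0 t2]; rewrite -cos_norm.
  have tl : `|t - phi| <= 2 * pi - d.
    by rewrite ler_norml; apply/andP; split; lra.
  rewrite cos_le_cos ?tl ?andbT ?d0 // normr_ge0 /=; lra.
apply/seteqP; split=> t; rewrite /pv_dom /= domE !in_itv /=.
  move=> [ti]; rewrite key //; case/andP: ti => t0 t2.
  by rewrite ler_normr => /orP[h|h]; [right|left]; apply/andP; split; lra.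
case=> /andP[t1 t2]; (have ti : 0 <= t <= 2 * pi by apply/andP; split; lra);
  split=> //; rewrite key // ler_normr; apply/orP; [right|left]; lra.
Qed.

Lemma pv_dom_compact eps d :
  pv_shape eps d ->
  compact (pv_dom eps).
Proof.
case=> -[_ [_ ->]]; last exact: segment_compact.
by apply: compactU; exact: segment_compact.
Qed.

Lemma pv_dom_neq eps t : 0 < eps -> pv_dom eps t -> expi t != z.
Proof.
move=> eps0 [_]; apply: contraTneq => ->.
by rewrite subrr cabs0 -ltNge.
Qed.

(** The primitive gains [c] over a period, which accounts for passing from 0 to $2\pi$; both shapes
    therefore give the same formula. *)
Lemma pv_dom_ftc (f E : R -> R) (c : R) eps d : 0 < eps -> 0 < d ->
  (forall t, expi t != z -> {for t, continuous f}) ->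
  (forall t, expi t != z -> is_derive t 1 E (f t)) ->
  (forall t, E (t + 2 * pi) = E t + c) ->
  pv_shape eps d ->
  \int[mu]_(t in pv_dom eps) f t = E (phi - d) - E (phi + d) + c.
Proof.
move=> eps0 d0 cf dE per sh; have cpt := pv_dom_compact sh.
have cf' t : pv_dom eps t -> {for t, continuous f}.
  by move=> /(pv_dom_neq eps0); exact: cf.
have dE' t : pv_dom eps t -> is_derive t 1 E (f t).
  by move=> /(pv_dom_neq eps0); exact: dE.
case: sh cpt cf' dE' => [[h1 [h2 ->]]|[ph0 [h1 ->]]] cpt cf' dE'; last first.
  rewrite (@ftc_segment f E) //.
  have -> : E (2 * pi - d) = E (- d) + c by rewrite -per addrC.
  by rewrite ph0 sub0r add0r; ring.
rewrite Rintegral_setU //.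
- have -> := @ftc_segment f E 0 (phi - d) h1
    (fun t ti => cf' t (or_introl ti)) (fun t ti => dE' t (or_introl ti)).
  have -> := @ftc_segment f E (phi + d) (2 * pi) h2
    (fun t ti => cf' t (or_intror ti)) (fun t ti => dE' t (or_intror ti)).
  by have := per 0; rewrite add0r => ->; ring.
- apply: continuous_compact_integrable => //.
  by apply: continuous_in_subspaceT => t; rewrite inE; exact: cf'.
- apply/disj_setPS => t [] /=; rewrite !in_itv /= => /andP[_ a1] /andP[a2 _].
  by exfalso; lra.
Qed.

Lemma pv_dom_le (f : R -> R) M eps d : 0 < eps -> 0 <= M ->
  (forall t, expi t != z -> {for t, continuous f}) ->
  (forall t, expi t != z -> `|f t| <= M) ->
  pv_shape eps d ->
  `|\int[mu]_(t in pv_dom eps) f t| <= M * (2 * pi).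
Proof.
move=> eps0 M0 cf fM sh; have cpt := pv_dom_compact sh.
have mS : measurable (pv_dom eps) by exact: measurable_realfun.compact_measurable.
have iS (g : R -> R) : (forall t, expi t != z -> {for t, continuous g}) ->
  mu.-integrable (pv_dom eps) (EFin \o g).
  move=> cg; apply: continuous_compact_integrable => //.
  apply: continuous_in_subspaceT => t; rewrite inE => /(pv_dom_neq eps0).
  exact: cg.
have hN := @le_normr_Rintegral _ _ R mu (pv_dom eps) f mS (iS f cf).
apply: (le_trans hN).
apply: (@le_trans _ _ (\int[mu]_(t in pv_dom eps) M)).
  apply: le_Rintegral => //.
  - apply: iS => t /cf ct; apply: continuous_comp => //; exact: norm_continuous.
  - by apply: iS => t _; exact: cst_continuous.
  - by move=> t /(pv_dom_neq eps0) /fM.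
rewrite Rintegral_cst // ler_wpM2l //.
have sub : pv_dom eps `<=` `[0, 2 * pi]%classic.
  by move=> t [ti _] /=; rewrite in_itv.
have p0 := pi_gt0 R.
have muT : mu `[0, 2 * pi]%classic = (2 * pi)%:E.
  by rewrite lebesgue_measure_itv /= lte_fin mulr_gt0 // sube0.
have -> : 2 * pi = fine (mu `[0, 2 * pi]%classic) by rewrite muT.
apply: fine_le.
- by rewrite ge0_fin_numE //; exact: compact_finite_measure.
- by rewrite muT.
- by apply: le_measure => //; rewrite inE.
Qed.

End PrincipalValue.

(** * Conjugate functions at a point and their principal-value formula *)

Section ConjugateFunction.
Variable R : realType.
Local Notation C := R[i].
Local Notation mu := (@lebesgue_measure R).

Lemma cderive_expi (t : R) : cderive (@expi R) t (Complex 0 1 * expi t).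
Proof.
split; rewrite /expi /=.
- by apply: is_derive_eq; ring.
- by apply: is_derive_eq; ring.
Qed.

(** Every nonzero frequency has a periodic primitive, so only the constant coefficient contributes
    over a period. *)
Lemma trig_primitive (Q : {poly C}) : exists2 E : R -> R,
  forall t : R, is_derive t 1 E (complex.Re Q.[expi t]) &
  forall t : R, E (t + 2 * pi) = E t + 2 * pi * complex.Re Q.[0].
Proof.
have [->|Q0] := eqVneq Q 0.
  exists (fun=> 0) => t; rewrite horner0 /=; first exact: is_derive_cst.
  by rewrite mulr0 addr0.
have key n : exists2 E : R -> R,
    forall t : R, is_derive t 1 E (complex.Re (\sum_(i < n.+1) Q`_i * expi t ^+ i)) &
    forall t, E (t + 2 * pi) = E t + 2 * pi * complex.Re Q`_0.
  elim: n => [|n [E dE pE]].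
    exists (fun t => t * complex.Re Q`_0).
    - move=> t; rewrite big_ord1 expr0 mulr1.
      apply: is_derive_eq (is_deriveM (is_derive_id t 1) (is_derive_cst _ t 1)) _.
      by rewrite /GRing.scale /=; ring.
    - by move=> t; ring.
  pose F t := complex.Im (Q`_n.+1 / n.+1%:R * expi t ^+ n.+1).
  exists (fun t => E t + F t).
  - move=> t; have h := dE t.
    have hX := cderiveX n (cderive_expi t).
    have [_ hF] := cderiveM (cderive_cst (Q`_n.+1 / n.+1%:R) t) hX.
    apply: is_derive_eq (is_deriveD h hF) _.
    rewrite [in RHS]big_ord_recr /= [in LHS]mul0r [in LHS]add0r.
    have -> : Q`_n.+1 / n.+1%:R * (n.+1%:R * expi t ^+ n * (Complex 0 1 * expi t)) =
       Complex 0 1 * (Q`_n.+1 * expi t ^+ n.+1).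
      have := natC_neq0 R n; set N : C := n.+1%:R => N0.
      by rewrite exprS; field.
    case: (\sum_(i < n.+1) _) => a b; case: (_ * expi t ^+ n.+1) => c d /=.
    by ring.
  - by move=> t; rewrite /F expi2pi pE; ring.
have [E dE pE] := key (size Q).-1; exists E => t.
- have h := dE t; apply: is_derive_eq h _; rewrite horner_coef.
  by rewrite prednK // size_poly_gt0.
- by rewrite pE -horner_coef0.
Qed.

Variable phi : R.
Local Notation z := (expi phi).

Definition hilbert_kernel t : R := complex.Im ((expi t + z) / (expi t - z)).
Local Notation K := hilbert_kernel.

(** The quotient is $i\cot((\phi-t)/2)$ away from $z$; at $z$ itself both sides are 0, since
    division by zero yields 0. *)
Lemma hilbert_kernelE t : (expi t + z) / (expi t - z) = Complex 0 (K t).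
Proof.
rewrite [LHS]complexE -/(K t); case E : (_ / _) => [a b].
suff -> : a = 0 by rewrite /= mulrC; simpc.
have -> : a = complex.Re ((expi t + z) / (expi t - z)) by rewrite E.
rewrite /expi /=; have := cos2Dsin2 t; have := cos2Dsin2 phi.
move: (cos t) (sin t) (cos phi) (sin phi) => x y c d h1 h2.
set n := (_ ^+ 2 + _ ^+ 2); transitivity (((x + c) * (x - c) + (y + d) * (y - d)) / n).
  by ring.
have -> : (x + c) * (x - c) + (y + d) * (y - d) = 0.
  transitivity ((x ^+ 2 + y ^+ 2) - (c ^+ 2 + d ^+ 2)); first by ring.
  by rewrite h1 h2 subrr.
by rewrite mul0r.
Qed.

Lemma hilbert_kernel_le t : `|K t| * cabs (expi t - z) <= 2.
Proof.
have [->|n0] := eqVneq (expi t) z; first by rewrite subrr cabs0 mulr0.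
have y0 : 0 < cabs (expi t - z) by rewrite cabs_gt0 subr_eq0.
rewrite -ler_pdivlMr //; apply: le_trans (Im_cabs _) _.
rewrite cabsM cabsV ler_wpM2r ?invr_ge0 ?cabs_ge0 //.
by apply: le_trans (cabsD _ _) _; rewrite !cabs_expi.
Qed.

Lemma cderive_expiB t : cderive (fun s => expi s - z) t (Complex 0 1 * expi t).
Proof.
have := cderiveD (cderive_expi t) (cderive_cst (- z) t).
by rewrite addr0.
Qed.

Lemma hilbert_kernel_primitive t : expi t != z ->
  is_derive t 1 (fun s => - ln (sqmod (expi s - z))) (K t).
Proof.
move=> tz; have y0 : expi t - z != 0 by rewrite subr_eq0.
have h := is_derive_ln_sqmod y0 (cderive_expiB t).
apply: is_derive_eq (is_deriveN h) _; rewrite /K.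
have -> : (expi t + z) / (expi t - z) = 2 * (expi t / (expi t - z)) - 1.
  by field.
have -> : Complex 0 1 * expi t / (expi t - z) = Complex 0 1 * (expi t / (expi t - z)).
  by rewrite mulrA.
by case: (expi t / _) => a b /=; ring.
Qed.

Lemma hilbert_kernel_cont t : expi t != z -> {for t, continuous K}.
Proof.
move=> tz; have y0 : expi t - z != 0 by rewrite subr_eq0.
apply: derivable_cont.
have [_ h] := cderiveM (cderiveD (cderive_expi t) (cderive_cst z t))
  (cderiveV y0 (cderive_expiB t)).
exact: ex_derive.
Qed.

(* [V] is, at [z], the conjugate function of [U]: on trigonometric
   polynomials [Re P] with [P 0 = 0] it is [Im P]. *)
Definition conjugate_at (U : C -> R) (V : R) : Prop :=
  forall eta : R, 0 < eta -> exists P : {poly C},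
    [/\ P.[0] = 0,
        forall t, `|(U (expi t) - complex.Re P.[expi t]) -
                    (U z - complex.Re P.[z])| <= eta * cabs (expi t - z) &
        `|complex.Im P.[z] - V| <= eta].

Lemma conjugate_atD U1 U2 V1 V2 : conjugate_at U1 V1 -> conjugate_at U2 V2 ->
  conjugate_at (fun x => U1 x + U2 x) (V1 + V2).
Proof.
move=> h1 h2 eta eta0; have e2 : 0 < eta / 2 by rewrite divr_gt0.
have [P [P0 hP vP]] := h1 _ e2; have [Q [Q0 hQ vQ]] := h2 _ e2.
have ReD (x y : C) : complex.Re (x + y) = complex.Re x + complex.Re y.
  by case: x y => [? ?] [? ?].
have ImD (x y : C) : complex.Im (x + y) = complex.Im x + complex.Im y.
  by case: x y => [? ?] [? ?].
exists (P + Q); split; first by rewrite hornerD P0 Q0 addr0.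
- move=> t; have := hP t; have := hQ t; rewrite !hornerD !ReD.
  set c := cabs _; rewrite !ler_norml => /andP[? ?] /andP[? ?].
  by apply/andP; split; lra.
- move: vP vQ; rewrite hornerD ImD !ler_norml => /andP[? ?] /andP[? ?].
  by apply/andP; split; lra.
Qed.

Lemma conjugate_at_cst (c : R) : conjugate_at (fun=> c) 0.
Proof.
move=> eta eta0; exists 0; split; rewrite ?horner0 //.
- by move=> t; rewrite horner0 subrr normr0 mulr_ge0 ?cabs_ge0 // ltW.
- by rewrite /= subr0 normr0 ltW.
Qed.

Lemma eq_conjugate_at U1 U2 V : (forall t, U1 (expi t) = U2 (expi t)) ->
  conjugate_at U1 V -> conjugate_at U2 V.
Proof.
move=> e h eta /h [P [h1 h2 h3]]; exists P; split=> // t.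
by rewrite -!e.
Qed.

(** The integrand splits into $K\,U(z)$, which cancels because the removed arc is symmetric,
    $K(\mathrm{Re}\,P-\mathrm{Re}\,P(z))$, a trigonometric polynomial of mean $\mathrm{Im}\,P(z)$,
    and a rest that is uniformly small because its Lipschitz bound at $z$ cancels the pole of
    $K$. *)
Lemma pv_cvg (U : C -> R) V : 0 <= phi -> phi < 2 * pi ->
  (forall t, {for t, continuous (fun s => U (expi s))}) -> conjugate_at U V ->
  \int[mu]_(t in pv_dom phi eps) (K t * U (expi t)) @[eps --> 0^'+]
    --> 2 * pi * V.
Proof.
move=> ph0 ph2 cU hU; have p0 := pi_gt0 R; have p4 : pi < 4 :> R.
  by have := pihalf_lt2 R; lra.
(* The errors add up to at most 26 [eta]: 16 for the rest, one for each side of the gap, and 8 for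
   replacing $\mathrm{Im}\,P(z)$ by [V]. *)
apply/cvgrPdist_le => e e0; pose eta := e / 27.
have eta0 : 0 < eta by rewrite divr_gt0.
have [P [P0 hP vP]] := hU _ eta0.
have z0 : z != 0 by rewrite -sqmod_eq0 sqmod_expi oner_eq0.
have /factor_theorem [Q0 hQ0] : root (P - P.[z]%:P) z.
  by rewrite /root !hornerE subrr.
have hQ x : P.[x] - P.[z] = Q0.[x] * (x - z).
  by have := congr1 (horner^~ x) hQ0; rewrite !hornerE.
(* On the circle $K=-i(x+z)/(x-z)$, and dividing $P-P(z)$ by $x-z$ removes the pole. From $P(0)=0$
   one gets $zQ_0(0)=P(z)$, hence $Q(0)=-iP(z)$. *)
pose Q := (Complex 0 (-1))%:P * ('X + z%:P) * Q0.
have QE x : Q.[x] = Complex 0 (-1) * (x + z) * Q0.[x] by rewrite /Q !hornerE.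
have Q00 : complex.Re Q.[0] = complex.Im P.[z].
  have h : z * Q0.[0] = P.[z].
    have := hQ 0; rewrite P0 !sub0r mulrN => /oppr_inj ->; exact: mulrC.
  rewrite QE add0r -mulrA h; case: (P.[z]) => a b /=; ring.
have KQ t : expi t != z ->
    K t * (complex.Re P.[expi t] - complex.Re P.[z]) = complex.Re Q.[expi t].
  move=> tz; have y0 : expi t - z != 0 by rewrite subr_eq0.
  rewrite QE.
  have -> : Q0.[expi t] = (P.[expi t] - P.[z]) / (expi t - z).
    by rewrite hQ mulfK.
  have -> : Complex 0 (-1) * (expi t + z) * ((P.[expi t] - P.[z]) / (expi t - z)) =
    Complex 0 (-1) * ((expi t + z) / (expi t - z)) * (P.[expi t] - P.[z]).
    by ring.
  rewrite hilbert_kernelE; case: (P.[expi t]) => a b; case: (P.[z]) => c d /=.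
  by ring.
have [EQ dEQ pEQ] := trig_primitive Q; rewrite Q00 in pEQ.
pose f t := K t * U z + complex.Re Q.[expi t].
pose E t := - ln (sqmod (expi t - z)) * U z + EQ t.
have dE (t : R) : expi t != z -> is_derive t 1 E (f t).
  move=> tz; have h1 := hilbert_kernel_primitive tz; have h2 := dEQ t.
  apply: is_derive_eq (is_deriveD (is_deriveM h1 (is_derive_cst (U z) t 1)) h2) _.
  by rewrite /f /GRing.scale /=; ring.
have pE t : E (t + 2 * pi) = E t + 2 * pi * complex.Im P.[z].
  by rewrite /E expi2pi pEQ; ring.
have cQ t : {for t, continuous (fun s => complex.Re Q.[expi s])}.
  apply: derivable_cont.
  have cpoly : exists d, cderive (fun s => Q.[expi s]) t d.
    eexists; under eq_fun do rewrite horner_coef.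
    apply: (@cderive_sum R (fun i s => Q`_i * expi s ^+ i)
      t (fun i => 0 * expi t ^+ i + Q`_i * (if i is j.+1 then
          j.+1%:R * expi t ^+ j * (Complex 0 1 * expi t) else 0))) => i.
    apply: cderiveM; first exact: cderive_cst.
    by case: i => [|j]; [exact: cderive_cst|exact/cderiveX/cderive_expi].
  by have [d [h _]] := cpoly; exact: ex_derive.
have cf t : expi t != z -> {for t, continuous f}.
  move=> tz; apply: continuousD; last exact: cQ.
  apply: continuousM; [exact: hilbert_kernel_cont|exact: cst_continuous].
pose g t := K t * U (expi t) - f t.
have cKU t : expi t != z -> {for t, continuous (fun s => K s * U (expi s))}.
  by move=> tz; apply: continuousM; [exact: hilbert_kernel_cont|exact: cU].
have cg t : expi t != z -> {for t, continuous g}.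
  by move=> tz; apply: continuousB; [exact: cKU|exact: cf].
have gle t : expi t != z -> `|g t| <= 2 * eta.
  move=> tz; rewrite /g /f -KQ //.
  have -> : K t * U (expi t) -
     (K t * U z + K t * (complex.Re P.[expi t] - complex.Re P.[z])) =
     K t * ((U (expi t) - complex.Re P.[expi t]) - (U z - complex.Re P.[z])).
    by ring.
  rewrite normrM.
  apply: le_trans (ler_wpM2l (normr_ge0 _) (hP t)) _.
  by rewrite mulrCA mulrC ler_wpM2r ?hilbert_kernel_le // ltW.
have [s s0 hs] : exists2 s : R, 0 < s &
    forall d, `|d| < s -> `|EQ phi - EQ (phi + d)| <= eta.
  have cEQ : {for phi, continuous EQ}.
    by apply: derivable_cont; have h := dEQ phi; exact: ex_derive.
  have /cvgrPdist_le /(_ _ eta0) := cEQ.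
  rewrite nearE => /nbhs_ballP [s s0 hs]; exists s => // d ds.
  apply: hs; rewrite /ball /= opprD addrA subrr sub0r normrN //.
have [e1 e10 sh] := pv_dom_shape ph0 ph2 s0.
near=> eps.
have eps0 : 0 < eps by near: eps; exact: nbhs_right_gt.
have [d /andP[d0 ds] shp] : exists2 d : R, 0 < d < s &
  pv_shape phi eps d.
  by apply: sh => //; near: eps; exact: nbhs_right_lt.
have cpt := pv_dom_compact shp.
have mS : measurable (pv_dom phi eps) by exact: measurable_realfun.compact_measurable.
have iS (h : R -> R) : (forall t, expi t != z -> {for t, continuous h}) ->
  mu.-integrable (pv_dom phi eps) (EFin \o h).
  move=> ch; apply: continuous_compact_integrable => //.
  apply: continuous_in_subspaceT => t; rewrite inE => /(pv_dom_neq eps0).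
  exact: ch.
have -> : \int[mu]_(t in pv_dom phi eps) (K t * U (expi t)) =
  \int[mu]_(t in pv_dom phi eps) g t + \int[mu]_(t in pv_dom phi eps) f t.
  have h := @RintegralD _ _ R mu (pv_dom phi eps) g f mS (iS _ cg) (iS _ cf).
  rewrite -[RHS]h.
  by apply: eq_Rintegral => t _; rewrite /g subrK.
have h1 := @pv_dom_ftc R phi f E _ eps d eps0 d0 cf dE pE shp.
have -> : \int[mu]_(t in pv_dom phi eps) f t =
    EQ (phi - d) - EQ (phi + d) + 2 * pi * complex.Im P.[z].
  rewrite h1; congr (_ + _); rewrite /E !sqmod_expiB.
  have -> : phi - d - phi = - d by ring.
  have -> : phi + d - phi = d by ring.
  by rewrite cosN; ring.
have e20 : 0 <= 2 * eta by lra.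
have h2 := pv_dom_le eps0 e20 cg gle shp.
have h3 : `|EQ phi - EQ (phi + d)| <= eta by apply: hs; rewrite gtr0_norm.
have h4 : `|EQ phi - EQ (phi - d)| <= eta by apply: hs; rewrite normrN gtr0_norm.
have h5 : `|2 * pi * complex.Im P.[z] - 2 * pi * V| <= 8 * eta.
  rewrite -mulrBr normrM ger0_norm; last by lra.
  by apply: ler_pM => //; lra.
have h6 : 2 * eta * (2 * pi) <= 16 * eta.
  have : 0 <= (4 - pi) * eta by apply: mulr_ge0; lra.
  by lra.
have e27 : e = 27 * eta by rewrite /eta; field.
move: h2 h3 h4 h5; rewrite !ler_norml => /andP[? ?] /andP[? ?] /andP[? ?] /andP[? ?].
by apply/andP; split; lra.
Unshelve. all: by end_near.
Qed.

(** The approximating polynomial is $-2$ times a Taylor polynomial of $-\log(1-\alpha x)$; the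
    degree is chosen to make the Lipschitz constant of the remainder small. *)
Lemma conjugate_log (al : C) : cabs al < 1 ->
  conjugate_at (fun x => ln (sqmod (1 - al * x))) (2 * arg (1 - al * z)).
Proof.
move=> al1 eta eta0; set r := cabs al in al1.
have r0 : 0 <= r by exact: cabs_ge0.
have [n hn] : exists n, 2 * r ^+ n / (1 - r) <= eta.
  have : (fun n => r ^+ n) @ \oo --> (0 : R) by apply: cvg_expr; rewrite ger0_norm.
  have c0 : 0 < eta * (1 - r) / 2 by rewrite divr_gt0 // mulr_gt0 // subr_gt0.
  move=> /cvgrPdist_le /(_ _ c0) [n _ /(_ n (leqnn n))] /=.
  rewrite sub0r normrN ger0_norm ?exprn_ge0 // => h; exists n.
  by rewrite ler_pdivrMr ?subr_gt0 //; lra.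
pose P : {poly C} := \sum_(i < n) (- 2 * al ^+ i.+1 / i.+1%:R) *: 'X^(i.+1).
have PE x : P.[x] = - 2 * log_taylor n (al * x).
  rewrite /P horner_sum /log_taylor mulr_sumr; apply: eq_bigr => i _.
  rewrite hornerZ hornerXn exprMn; have := natC_neq0 R i; set N : C := i.+1%:R => N0.
  by field.
have RePE x : complex.Re P.[x] = - 2 * complex.Re (log_taylor n (al * x)).
  by rewrite PE; case: (log_taylor _ _) => a b /=; ring.
have ImPE x : complex.Im P.[x] = - 2 * complex.Im (log_taylor n (al * x)).
  by rewrite PE; case: (log_taylor _ _) => a b /=; ring.
exists P; split.
- rewrite PE mulr0 /log_taylor big1 ?mulr0 // => i _.
  by rewrite expr0n mul0r.
- move=> t; set y := expi t; rewrite !RePE.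
  have y1 : cabs y = 1 by rewrite cabs_expi.
  have z1 : cabs z = 1 by rewrite cabs_expi.
  have [||h _] := @log_taylor_lip R n r (al * z) (al * (y - z)).
  + by rewrite r0.
  + move=> s /andP[s0 s1].
    have -> : al * z + real_complex R s * (al * (y - z)) =
      al * (real_complex R (1 - s) * z + real_complex R s * y).
      by rewrite rmorphB /=; ring.
    rewrite cabsM -/r ler_piMr //; apply: le_trans (cabsD _ _) _.
    rewrite !cabsM y1 z1 !mulr1 !cabs_real !ger0_norm //; lra.
  have e1 : al * z + al * (y - z) = al * y by ring.
  rewrite e1 cabsM -/r in h.
  have c0 := cabs_ge0 (y - z).
  have hb : r * cabs (y - z) * r ^+ n / (1 - r) <= eta / 2 * cabs (y - z).
    have -> : r * cabs (y - z) * r ^+ n / (1 - r) =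
      (r * (r ^+ n / (1 - r))) * cabs (y - z) by ring.
    apply: ler_wpM2r => //; rewrite ler_pdivlMr //.
    have h0 : 0 <= r ^+ n / (1 - r) by rewrite divr_ge0 ?exprn_ge0 // subr_ge0 ltW.
    have : r * (r ^+ n / (1 - r)) <= r ^+ n / (1 - r) by rewrite ler_piMl // ltW.
    by move: hn; rewrite -mulrA; lra.
  have := le_trans h hb; rewrite !ler_norml => /andP[? ?].
  by apply/andP; split; lra.
- rewrite ImPE; have hz : cabs (al * z) = r by rewrite cabsM cabs_expi mulr1.
  have := @arg_taylor R n (al * z); rewrite hz => /(_ al1) h.
  have h0 : 0 <= r ^+ n / (1 - r) by rewrite divr_ge0 ?exprn_ge0 // subr_ge0 ltW.
  have h1 : r * (r ^+ n / (1 - r)) <= r ^+ n / (1 - r) by rewrite ler_piMl // ltW.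
  move: hn h; rewrite -!mulrA ler_norml => hn /andP[? ?].
  by rewrite ler_norml; apply/andP; split; lra.
Qed.

End ConjugateFunction.

(** * From the matrix product and the principal value to the sum of principal arguments *)

Section ArgFormula.
Variable R : realType.
Local Notation C := R[i].

Fixpoint lin_poly (G : nat -> C) n : {poly C} * {poly C} :=
  if n is m.+1 then
    let p := lin_poly G m in
    (p.1 + (G m)%:P * p.2, 'X * (p.2 + (conjc (G m))%:P * p.1))
  else (1, 0).

Lemma lin_polyE G n (x : C) :
  (lin_poly G n).1.[x] = (lin G x (1, 0) n).1 /\
  (lin_poly G n).2.[x] = (lin G x (1, 0) n).2.
Proof.
elim: n => [|n [h1 h2]] /=; first by rewrite !hornerE.
by rewrite !hornerE h1 h2.
Qed.

Lemma lin_at0 G n : lin G 0 (1, 0 : C) n = (1, 0).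
Proof. by elim: n => [//|n IH] /=; rewrite IH /= mul0r mulr0 addr0. Qed.

Lemma lin_neq0 G n (x : C) : (forall m, cabs (G m) < 1) -> cabs x <= 1 ->
  (lin G x (1, 0) n).1 != 0.
Proof.
move=> G1 x1; have o1 : cabs (0 : C) <= 1 by rewrite cabs0 ler01.
have [-> _] := linE n G1 x1 o1.
by apply/prodf_neq0 => m _; exact/Re_gt0_neq0/chain_Re_gt0.
Qed.

(** The polynomial has no zero in the closed disc and equals 1 at 0. The latter fixes the leading
    coefficient, and the [w] are the inverses of the roots. *)
Lemma lin_factorization G n : (forall m, cabs (G m) < 1) ->
  exists2 r : seq C, (forall w, w \in r -> cabs w < 1) &
    forall x, (lin G x (1, 0) n).1 = \prod_(w <- r) (1 - w * x).
Proof.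
move=> G1; set p := (lin_poly G n).1.
have pE x : p.[x] = (lin G x (1, 0) n).1 by have [] := lin_polyE G n x.
have p0 : p.[0] = 1 by rewrite pE lin_at0.
have [s ps] := closed_field_poly_normal p.
have pnz : p != 0.
  by apply/eqP => h; move: p0; rewrite h horner0 => /eqP; rewrite eq_sym oner_eq0.
have rs w : w \in s -> root p w.
  by move=> ws; rewrite ps rootZ ?lead_coef_eq0 // root_prod_XsubC.
have s1 w : w \in s -> 1 < cabs w.
  move=> /rs; rewrite /root pE; apply: contraTT; rewrite -leNgt.
  exact: lin_neq0.
exists [seq w^-1 | w <- s].
  move=> w /mapP [u us ->]; rewrite cabsV invf_lt1 ?s1 //.
  exact: lt_trans ltr01 (s1 u us).
move=> x; rewrite big_map -pE.
have hp y : p.[y] = lead_coef p * \prod_(w <- s) (y - w).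
  rewrite {1}ps hornerZ horner_prod; congr (_ * _).
  by apply: eq_bigr => w _; rewrite hornerXsubC.
have h0 := hp 0; rewrite p0 in h0.
have e : \prod_(w <- s) (x - w) =
    \prod_(w <- s) (0 - w) * \prod_(w <- s) (1 - w^-1 * x).
  rewrite -big_split /= !big_seq; apply: eq_bigr => w ws.
  have w0 : w != 0 by rewrite -cabs_gt0 (lt_trans ltr01 (s1 w ws)).
  by field.
by rewrite hp e mulrA -h0 mul1r.
Qed.

Lemma polar_prod_seq (r : seq C) (z : C) : cabs z <= 1 ->
  (forall w, w \in r -> cabs w < 1) ->
  polar (fun t => \prod_(w <- r) (1 - w * (real_complex R t * z)))
        (fun t => \sum_(w <- r) arg (1 - w * (real_complex R t * z))).
Proof.
move=> z1 r1; have := @polar_prod R (size r)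
  (fun i t => 1 - r`_i * (real_complex R t * z))
  (fun i t => arg (1 - r`_i * (real_complex R t * z))).
have -> : (fun t => \prod_(i < size r) (1 - r`_i * (real_complex R t * z))) =
  (fun t => \prod_(w <- r) (1 - w * (real_complex R t * z))).
  by apply/funext => t; rewrite (big_nth 0) big_mkord.
have -> : (fun t => \sum_(i < size r) arg (1 - r`_i * (real_complex R t * z))) =
  (fun t => \sum_(w <- r) arg (1 - w * (real_complex R t * z))).
  by apply/funext => t; rewrite (big_nth 0) big_mkord.
apply=> i ir; have ri := r1 _ (mem_nth 0 ir); apply: polar_arg.
- move=> t /andP[t0 t1].
  have -> : 1 - r`_i * (real_complex R t * z) = 1 + r`_i * - (real_complex R t * z).
    by rewrite mulrN.
  apply: Re_1D_gt0M => //; rewrite cabsN cabsM cabs_real ger0_norm //.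
  by rewrite -[1]mulr1 ler_pM ?cabs_ge0.
- move=> t _; have := cderiveD (cderive_cst 1 t) (cderiveM (cderive_cst (- r`_i) t)
    (cderiveM (cderive_real t) (cderive_cst z t))).
  by move=> h; eexists; move: h; congr cderive; apply/funext => s; rewrite mulNr.
Qed.

(** Both sides come from arguments of the same polynomial along the ray $tz$, and both vanish at
    $t=0$. *)
Lemma chain_arg_roots G n (r : seq C) (z : C) : (forall m, cabs (G m) < 1) ->
  cabs z <= 1 -> (forall w, w \in r -> cabs w < 1) ->
  (forall x, (lin G x (1, 0) n).1 = \prod_(w <- r) (1 - w * x)) ->
  \sum_(w <- r) arg (1 - w * z) = chain_arg G z 0 n.
Proof.
move=> G1 z1 r1 rE.
pose zt (t : R) := real_complex R t * z.
have zt1 t : 0 <= t <= 1 -> cabs (zt t) <= 1.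
  move=> /andP[t0 t1]; rewrite cabsM cabs_real ger0_norm //.
  by rewrite -[1]mulr1 ler_pM ?cabs_ge0.
have o1 : cabs (0 : C) <= 1 by rewrite cabs0 ler01.
have h1 := @polar_chain R G zt (fun=> 0) n G1 zt1 (fun _ _ => o1)
  (fun t _ => ex_intro _ _ (cderiveM (cderive_real t) (cderive_cst z t)))
  (fun t _ => ex_intro _ _ (cderive_cst 0 t)).
have h2 := polar_prod_seq z1 r1.
have e : (fun t => (lin G (zt t) (1, 0) n).1) =
  (fun t => \prod_(w <- r) (1 - w * (real_complex R t * z))).
  by apply/funext => t; rewrite rE.
rewrite e in h1; have := polar_uniq h2 h1.
rewrite /zt !mul1r; apply; rewrite !mul0r.
have c0 m : chain G 0 (0 : C) m = 0 by case: m => // m /=; rewrite !mul0r.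
rewrite big1; last by move=> w _; rewrite mulr0 subr0 arg1.
by rewrite /chain_arg big1 // => m _; rewrite c0 mulr0 addr0 arg1.
Qed.

Lemma conjugate_log_lin G n (phi : R) : (forall m, cabs (G m) < 1) ->
  conjugate_at phi (fun x => ln (sqmod (lin G x (1, 0) n).1))
    (2 * chain_arg G (expi phi) 0 n).
Proof.
move=> G1; have [r r1 rE] := lin_factorization n G1.
have z1 : cabs (expi phi) <= 1 by rewrite cabs_expi.
rewrite -(chain_arg_roots G1 z1 r1 rE).
apply: (@eq_conjugate_at _ _ (fun x => ln (sqmod (\prod_(w <- r) (1 - w * x))))).
  by move=> t; rewrite rE.
elim: r r1 {rE} => [|w r IH] r1.
  rewrite big_nil mulr0; apply: (@eq_conjugate_at _ _ (fun=> 0)).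
    by move=> t; rewrite big_nil sqmod1 ln1.
  exact: conjugate_at_cst.
rewrite big_cons mulrDr.
have IH' := IH (fun u ur => r1 u (mem_behead (s := w :: r) ur)).
have w1 : cabs w < 1 by apply: r1; rewrite mem_head.
have := conjugate_atD (conjugate_log phi w1) IH'; apply: eq_conjugate_at => t.
have nz u : u \in w :: r -> 1 - u * expi t != 0.
  move=> /r1 u1; apply: Re_gt0_neq0; rewrite -mulrN; apply: Re_1D_gt0M => //.
  by rewrite cabsN cabs_expi.
have pos x : x != 0 -> (sqmod x : R) \is Num.pos.
  by move=> x0; rewrite posrE lt0r sqmod_eq0 x0 sqmod_ge0.
rewrite big_cons sqmodM lnM //; apply: pos; first by apply: nz; rewrite mem_head.
rewrite prodf_seq_neq0; apply/allP => u ur /=; apply: nz.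
by rewrite in_cons ur orbT.
Qed.

Lemma cderive_lin G n t : exists d,
  cderive (fun s => (lin G (expi s) (1, 0 : C) n).1) t d.
Proof.
suff [] : (exists d, cderive (fun s => (lin G (expi s) (1, 0 : C) n).1) t d) /\
  (exists d, cderive (fun s => (lin G (expi s) (1, 0 : C) n).2) t d) by [].
elim: n => [|n [[d1 h1] [d2 h2]]] /=.
  by split; eexists; exact: cderive_cst.
split; eexists.
- exact: cderiveD h1 (cderiveM (cderive_cst _ _) h2).
- exact: cderiveM (cderive_expi t) (cderiveD h2 (cderiveM (cderive_cst _ _) h1)).
Qed.

Lemma factor_id (F : int -> C) n z : F n = 0 -> Defs.factor F n z = 1.
Proof.
move=> Fn; rewrite /Defs.factor Fn sqmod0 subr0 sqrtr1 invr1 scale1r.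
apply/matrixP => i j; rewrite !mxE conjc0 !mul0r if_same.
by case: (i == j).
Qed.

Definition partial_transfer (F : int -> C) (z : C) n : 'M[C]_2 :=
  \prod_(i < n) Defs.factor F (n.-1%:Z - i%:Z) z.

Lemma partial_transferS F z n :
  partial_transfer F z n.+1 = Defs.factor F n%:Z z * partial_transfer F z n.
Proof.
rewrite /partial_transfer big_ord_recl /= subr0; congr (_ * _).
case: n => [|n]; first by rewrite !big_ord0.
apply: eq_bigr => i _; congr Defs.factor.
by rewrite /= /bump /=; lia.
Qed.

Lemma transfer_trunc (F : int -> C) N z : (forall n, n < 0 -> F n = 0) ->
  transfer (trunc F N) N z = partial_transfer F z N.+1.
Proof.
move=> F0; rewrite /transfer /partial_transfer.
(* The first $N+1$ factors have indices $N,\dots,0$; the remaining $N$ have negative indices and are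
   identities. *)
have e : (N + N).+1 = (N.+1 + N)%N by [].
rewrite e big_split_ord /= [X in _ * X]big1 ?mulr1.
  apply: eq_bigr => i _; rewrite /Defs.factor /trunc.
  suff -> : (absz (N%:Z - i%:Z) <= N)%N by [].
  by have := ltn_ord i; lia.
move=> i _; apply: factor_id; rewrite /trunc; case: ifP => // _; apply: F0.
by rewrite /=; lia.
Qed.

(** The first column obeys a recursion with coefficients $z^{\pm n}$. Conjugating it and absorbing
    $z^n$ into the lower entry leaves a bare factor $z$ per step, because $\bar z=z^{-1}$; [c]
    collects the normalizing factors. *)
Lemma transfer_lin (F : int -> C) z n : (forall n, cabs (F n) < 1) ->
  sqmod z = 1 ->
  exists2 c : R, c ^+ 2 * defect (fun m => F m%:Z) n = 1 &
   conjc (partial_transfer F z n 0 0) =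
     real_complex R c * (lin (fun m => F m%:Z) z (1, 0) n).1 /\
   conjc (partial_transfer F z n 1 0) * z ^+ n =
     real_complex R c * (lin (fun m => F m%:Z) z (1, 0) n).2.
Proof.
move=> F1 z1; elim: n => [|n [c cE [h1 h2]]].
  exists 1; first by rewrite /defect big_ord0 mulr1 expr1n.
  have m0 : (1 : 'M[C]_2) 0 0 = 1 by rewrite mxE.
  have m1 : (1 : 'M[C]_2) 1 0 = 0 by rewrite mxE.
  by rewrite /partial_transfer big_ord0 m0 m1 conjc1 conjc0 !mulr0 mul0r mulr1.
set g := F n%:Z; set k := (Num.sqrt (1 - sqmod g))^-1.
have g1 : 0 < 1 - sqmod g.
  by rewrite subr_gt0 -cabs_sq expr_lt1 ?cabs_ge0 // F1.
have k2 : k ^+ 2 * (1 - sqmod g) = 1.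
  by rewrite /k exprVn sqr_sqrtr ?ltW // mulVf // gt_eqF.
exists (c * k).
  rewrite /defect big_ord_recr /= -/(defect (fun m => F m%:Z) n) -/g.
  set D := defect _ n in cE *.
  transitivity ((c ^+ 2 * D) * (k ^+ 2 * (1 - sqmod g))); first by ring.
  by rewrite cE k2 mulr1.
have zz : conjc z * z = 1 by exact: conj_unit.
have zn : conjc z ^+ n * z ^+ n = 1 by rewrite -exprMn zz expr1n.
have z0 : z != 0 by rewrite -sqmod_eq0 z1 oner_eq0.
have zV : z ^ (- n%:Z) = conjc z ^+ n.
  rewrite -exprnN; apply: (mulIf (expf_neq0 n z0)).
  by rewrite mulVf ?expf_neq0.
have l1 : lift ord0 ord0 = 1 :> 'I_2 by apply/val_inj.
have e0 : partial_transfer F z n.+1 0 0 = real_complex R k *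
   (partial_transfer F z n 0 0 + conjc g * conjc z ^+ n * partial_transfer F z n 1 0).
  rewrite partial_transferS [LHS]mxE big_ord_recl big_ord1 l1 !mxE /= zV -/g -/k.
  by ring.
have e1 : partial_transfer F z n.+1 1 0 = real_complex R k *
   (g * z ^+ n * partial_transfer F z n 0 0 + partial_transfer F z n 1 0).
  rewrite partial_transferS [LHS]mxE big_ord_recl big_ord1 l1 !mxE /= -/g -/k.
  by rewrite -exprnP; ring.
have ck : real_complex R (c * k) = real_complex R c * real_complex R k.
  by rewrite rmorphM.
have kJ : conjc (real_complex R k) = real_complex R k by exact: conjc_real.
rewrite {}ck; move: (real_complex R k) kJ e0 e1 => k' kJ e0 e1.
rewrite e0 e1 !(rmorphM, rmorphD, rmorphXn) /= !conjcK !kJ.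
move: h1 h2; set a := conjc (partial_transfer F z n 0 0).
set b := conjc (partial_transfer F z n 1 0).
set A := (lin _ _ _ _).1; set Y := (lin _ _ _ _).2 => h1 h2.
set c' := real_complex R c in h1 h2 *; set gb := conjc g; split.
- transitivity (k' * (a + g * (b * z ^+ n))); first by ring.
  by rewrite -/g h1 h2; ring.
- transitivity (k' * z * (gb * a * (conjc z ^+ n * z ^+ n) + b * z ^+ n)).
    by rewrite exprS; ring.
  by rewrite zn h1 h2; ring.
Qed.

(** This is $1+|b|^2=|a^\ast|^2$ with the normalization made explicit. *)
Lemma bcoef_lin (F : int -> C) N z : (forall n, n < 0 -> F n = 0) ->
  (forall n, cabs (F n) < 1) -> sqmod z = 1 ->
  1 + sqmod (bcoef (trunc F N) N z) = (defect (fun m => F m%:Z) N.+1)^-1 *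
    sqmod (lin (fun m => F m%:Z) z (1, 0) N.+1).1.
Proof.
move=> F0 F1 z1; rewrite /bcoef transfer_trunc //.
have [c cE [_ h]] := transfer_lin N.+1 F1 z1.
have [e _ _] := lin_unitary (fun m => F m%:Z) N.+1 z1.
have zn : sqmod (z ^+ N.+1) = 1 by rewrite -cabs_sq cabsX cabs_eq1 // !expr1n.
have := congr1 (@sqmod R) h; rewrite sqmodM sqmodJ zn mulr1 sqmodM sqmod_real => ->.
set G := fun m : nat => F m%:Z in cE e *; set D := defect G N.+1 in cE e *.
have D0 : D != 0.
  by apply/eqP => D0; move/eqP: cE; rewrite D0 mulr0 eq_sym oner_eq0.
have c2 : c ^+ 2 = D^-1 by apply: (mulIf D0); rewrite cE mulVf.
rewrite c2 -[1 in LHS](mulVf D0) -mulrDr; congr (_ * _).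
by rewrite -e subrK.
Qed.

(** The normalization only adds a constant to $\log(1+|b|^2)$, and constants have conjugate function
    0. *)
Lemma arg_astarE (F : int -> C) N phi : (forall n, n < 0 -> F n = 0) ->
  (forall n, cabs (F n) < 1) -> 0 <= phi -> phi < 2 * pi ->
  arg_astar (trunc F N) N (expi phi) =
  chain_arg (fun m => F m%:Z) (expi phi) 0 N.+1.
Proof.
move=> F0 F1 ph0 ph2; set G := fun m : nat => F m%:Z.
have G1 m : cabs (G m) < 1 by exact: F1.
pose L x := ln (sqmod (lin G x (1, 0) N.+1).1).
pose U x := ln (1 + sqmod (bcoef (trunc F N) N x)).
have UL t : L (expi t) + ln (defect G N.+1)^-1 = U (expi t).
  rewrite /U /L bcoef_lin ?sqmod_expi // addrC lnM //.
  - by rewrite posrE invr_gt0 defect_gt0.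
  - by rewrite posrE lt0r sqmod_eq0 sqmod_ge0 andbT lin_neq0 ?cabs_expi.
have hU : conjugate_at phi U (2 * chain_arg G (expi phi) 0 N.+1).
  have := conjugate_atD (conjugate_log_lin N.+1 phi G1)
    (conjugate_at_cst phi (ln (defect G N.+1)^-1)).
  by rewrite addr0; exact: eq_conjugate_at.
have cU t : {for t, continuous (fun s => U (expi s))}.
  have -> : (fun s => U (expi s)) = (fun s => L (expi s) + ln (defect G N.+1)^-1).
    by apply/funext => s; rewrite UL.
  apply: continuousD; last exact: cst_continuous.
  apply: derivable_cont; have [d hd] := cderive_lin G N.+1 t.
  have nz : (lin G (expi t) (1, 0) N.+1).1 != 0 by rewrite lin_neq0 ?cabs_expi.
  by have h := is_derive_ln_sqmod nz hd; exact: ex_derive.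
have := pv_cvg ph0 ph2 cU hU => /cvg_lim hlim.
rewrite /arg_astar (_ : lim _ = 2 * pi * (2 * chain_arg G (expi phi) 0 N.+1)).
  have p0 : pi != 0 :> R by rewrite gt_eqF // pi_gt0.
  have -> (A : R) : 2 * pi * (2 * A) = 4 * pi * A by ring.
  by rewrite mulKf // mulf_neq0.
exact: hlim.
Qed.

End ArgFormula.

(** * The scanning sequence and the harmonic growth of its argument *)

Section Construction.
Variable R : realType.
Local Notation C := R[i].

Lemma circle_param (z : C) : sqmod z = 1 ->
  exists2 phi : R, 0 <= phi < 2 * pi & z = expi phi.
Proof.
case: z => a b; rewrite /sqmod /= => h; have p0 := pi_gt0 R.
have ai : -1 <= a <= 1.
  by rewrite -ler_norml -(@ler_pXn2r _ 2) ?nnegrE // real_normK ?num_real // expr1n -h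
             lerDl sqr_ge0.
have ca : cos (acos a) = a by rewrite acosK.
have sa : sin (acos a) = `|b|.
  by rewrite sin_acos // -h addrC addKr sqrtr_sqr.
have d0 := acos_ge0 ai; have d1 := acos_lepi ai.
have [b0|b0] := leP 0 b.
  exists (acos a); first by apply/andP; split; lra.
  by rewrite /expi ca sa ger0_norm.
have a1 : -1 <= a < 1.
  by case/andP: ai => -> _ /=; nra.
have d2 := acos_gt0 a1.
exists (2 * pi - acos a); first by apply/andP; split; lra.
rewrite addrC expi2pi expiN /expi ca sa ltr0_norm //= opprK.
by [].
Qed.

Lemma sin_le (x : R) : 0 <= x -> `|sin x| <= x.
Proof.
move=> x0.
have [|c _] := @MVT_segment R (@sin R) (@cos R) 0 x x0 (fun y _ => is_derive_sin y).
  by apply: continuous_subspaceT => y; exact: continuous_sin.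
rewrite sin0 !subr0 => ->; rewrite normrM (ger0_norm x0).
by rewrite ler_piMl // cos_max.
Qed.

Lemma cos_ge (x : R) : 0 <= x -> 1 - x ^+ 2 / 2 <= cos x.
Proof.
move=> x0; pose y := x / 2.
have y0 : 0 <= y by rewrite divr_ge0.
have xE : x = y *+ 2 by rewrite -mulr_natr divfK // pnatr_eq0.
have : `|sin y| ^+ 2 <= y ^+ 2 by apply: lerXn2r; rewrite ?nnegrE // sin_le.
rewrite real_normK ?num_real // => hs.
have -> : x ^+ 2 / 2 = y ^+ 2 * 2 by rewrite /y; field.
rewrite [in X in _ <= X]xE cos_mulr2n cos2sin2.
by rewrite mulr2n; lra.
Qed.

Lemma sin_ge (x : R) : 0 <= x <= 1 -> x / 2 <= sin x.
Proof.
move=> /andP[x0 x1].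
have [|c ci] := @MVT_segment R (@sin R) (@cos R) 0 x x0 (fun y _ => is_derive_sin y).
  by apply: continuous_subspaceT => y; exact: continuous_sin.
rewrite sin0 !subr0 => ->; rewrite mulrC ler_wpM2r //.
move: ci; rewrite in_itv /= => /andP[c0 cx].
by apply: le_trans (cos_ge c0); nra.
Qed.

Lemma cauchy_kernelE (x : R) :
  complex.Im (expi x / (1 - expi x)) = sin x / (2 - 2 * cos x).
Proof.
have -> : 2 - 2 * cos x = sqmod (1 - expi x).
  have := @sqmod_expiB R 0 x; rewrite expi0 sub0r cosN => ->; by [].
rewrite /expi /sqmod /=; set n := (_ ^+ 2 + _ ^+ 2).
by ring.
Qed.

Lemma cabs_1Bexpi_ge (x : R) : 0 <= x <= 1 -> x / 2 <= cabs (1 - expi x).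
Proof.
move=> xi; apply: le_trans (sin_ge xi) _; apply: le_trans (Im_cabs _).
by rewrite /expi /= sub0r normrN ler_norm.
Qed.

(** The left-out form of the kernel is $\frac12\cot(x/2)=\sin x/(2-2\cos x)$; the bound follows from
    $\sin x\ge x/2$ and $2-2\cos x\le x^2$. *)
Lemma cauchy_kernel_ge (x : R) : 0 < x <= 1 ->
  (2 * x)^-1 <= complex.Im (expi x / (1 - expi x)).
Proof.
move=> /andP[x0 x1]; have xi : 0 <= x <= 1 by rewrite ltW.
have s0 := sin_ge xi; have c0 := cos_ge (ltW x0).
rewrite cauchy_kernelE.
have n0 : 0 < 2 - 2 * cos x.
  have := cabs_1Bexpi_ge xi; have -> : 2 - 2 * cos x = cabs (1 - expi x) ^+ 2.
    by rewrite cabs_sq; have := @sqmod_expiB R 0 x; rewrite expi0 sub0r cosN => ->.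
  by move=> h; apply: exprn_gt0; lra.
rewrite ler_pdivlMr // mulrC ler_pdivrMr; last by lra.
have h1 : 2 - 2 * cos x <= x ^+ 2 by lra.
apply: le_trans h1 _; nra.
Qed.

Lemma harmonic_unbounded (A : R) : exists q, A <= \sum_(i < q) (i.+2%:R)^-1.
Proof.
apply: contrapT => h; apply: (@dvg_harmonic R).
apply: nondecreasing_is_cvgn.
  apply: nondecreasing_series => n _ _; rewrite /= invr_ge0; exact: ler0n.
exists (1 + A) => _ [n _ <-]; rewrite /series /= big_mkord.
case: n => [|n].
  rewrite big_ord0; apply: contrapT => hA; apply: h; exists 0%N.
  by rewrite big_ord0; move/negP: hA; rewrite -ltNge; lra.
rewrite big_ord_recl /= invr1 lerD2l.
apply: contrapT => hA; apply: h; exists n.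
by move/negP: hA; rewrite -ltNge => /ltW.
Qed.

Lemma ler_telescope (f b : nat -> R) n :
  (forall i, (i < n)%N -> b i <= f i.+1 - f i) ->
  \sum_(i < n) b i <= f n - f 0.
Proof.
elim: n => [|n IH] h; first by rewrite big_ord0 subrr.
rewrite big_ord_recr /=; have h1 := h n (ltnSn n).
have h2 := IH (fun i lin => h i (leqW lin)).
by lra.
Qed.

Variables (w : R) (q : nat).
Hypotheses (w_gt0 : 0 < w) (w_le : w <= 8^-1).

(** Here [q] counts the blocks used on one side of a point. The 8 keeps $q+1$ spacings within
    $\pi/4<1$, where the kernel bounds hold, and leaves room for [q] blocks on some side of every
    point. Since [rt] is the square root of the total length [k * blen], the height [e] gives mass
    $w^2$; its factor $5(q+1)$ makes the error of a block at most $1/(q+1)$. *)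
Let k : nat := (8 * q.+1)%N.
Let blen : nat := (25 * q.+1 ^ 2 * k)%N.
Let rt : nat := (5 * q.+1 * k)%N.
Let e : R := w / rt%:R.
Let h : R := 2 * pi / k%:R.

Let k_gt0 : 0 < k%:R :> R. Proof. by rewrite ltr0n. Qed.
Let rt_gt0 : 0 < rt%:R :> R. Proof. by rewrite ltr0n. Qed.
Let e_gt0 : 0 < e. Proof. exact: divr_gt0. Qed.
Let e_lt1 : e < 1.
Proof.
rewrite ltr_pdivrMr // mul1r; apply: (@lt_le_trans _ _ 1).
  by apply: le_lt_trans w_le _; lra.
by rewrite ler1n -(ltr_nat R).
Qed.
Let kblen : (k * blen = rt * rt)%N. Proof. by rewrite /blen /rt; ring. Qed.
Let blen_e2 : blen%:R * e ^+ 2 = w ^+ 2 / k%:R.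
Proof.
have h1 : k%:R * blen%:R = rt%:R * rt%:R :> R by rewrite -!natrM kblen.
have k0 : k%:R != 0 :> R by rewrite gt_eqF.
have r0 : rt%:R != 0 :> R by rewrite gt_eqF.
apply: (mulfI k0); rewrite mulrA h1 /e.
set K : R := k%:R in k0 *; set r : R := rt%:R in r0 *.
by field; rewrite k0 r0.
Qed.

Definition scan_angle (l : nat) : R := l%:R * h.

(* The l-th of the k blocks of length blen is a pure frequency at the angle
   [scan_angle l]; successive blocks sweep once around the circle. *)
Definition scan (n : int) : C :=
  match n with
  | Posz m => if (m < k * blen)%N then
      real_complex R e * conjc (expi (scan_angle (m %/ blen))) ^+ (m %% blen)
    else 0
  | Negz _ => 0
  end.

Lemma cabs_scan n : cabs (scan n) <= e.
Proof.
case: n => m; rewrite /scan; last by rewrite cabs0 ltW.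
case: ifP => _; last by rewrite cabs0 ltW.
by rewrite cabsM cabs_real cabsX cabsJ cabs_expi expr1n mulr1 gtr0_norm.
Qed.

Lemma cabs_scan_lt1 n : cabs (scan n) < 1.
Proof. exact: le_lt_trans (cabs_scan n) e_lt1. Qed.

Lemma scan_Sstar : Sstar scan.
Proof.
split; first by exists e; split=> // n; exact: cabs_scan.
move=> l; exists ((1 + (k * blen)%:R) ^+ l) => n.
have p0 m : 0 < (1 + m%:R : R) ^+ l by rewrite exprn_gt0 // ltr_pwDl.
rewrite -/(cabs (scan n)) ler_pdivlMr //.
case: n => m; rewrite /scan; last by rewrite cabs0 mul0r; exact/ltW/p0.
case: ifP => mk; last by rewrite cabs0 mul0r; exact/ltW/p0.
have h1 : (1 + m%:R : R) ^+ l <= (1 + (k * blen)%:R) ^+ l.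
  by rewrite lerXn2r ?nnegrE ?addr_ge0 ?ler0n // lerD2l ler_nat ltnW.
apply: le_trans h1; apply: ler_piMl; first exact/ltW/p0.
by have := cabs_scan_lt1 (Posz m); rewrite /scan mk => /ltW.
Qed.

Lemma scan_l2 : (l2normsq scan <= (w ^+ 2)%:E)%E.
Proof.
rewrite /l2normsq.
have -> : (\esum_(n in [set: int]) (sqmod (scan n))%:E =
  \esum_(n in [set Posz m | m in `I_(k * blen)]) (sqmod (scan n))%:E)%E.
  rewrite [RHS]esum_mkcond; apply: eq_esum => n _; case: ifPn => // nk.
  case: n nk => m nk; rewrite /scan; last by rewrite sqmod0.
  case: ifPn => mk; last by rewrite sqmod0.
  by exfalso; move/negP: nk; apply; rewrite inE; exists m.
rewrite esum_image; last by move=> x y _ _ [].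
rewrite esum_fset //; last by move=> i _; rewrite lee_fin sqmod_ge0.
rewrite -fsbig_ord sumEFin lee_fin.
apply: (@le_trans _ _ (\sum_(i < k * blen) e ^+ 2)).
  apply: ler_sum => i _; rewrite -cabs_sq lerXn2r ?nnegrE ?cabs_ge0 //.
    exact: ltW.
  exact: cabs_scan.
rewrite sumr_const card_ord -mulr_natl natrM -mulrA blen_e2 mulrCA divff ?mulr1 //.
by rewrite gt_eqF.
Qed.

Let G (m : nat) : C := scan m%:Z.
Let A (phi : R) n : R := chain_arg G (expi phi) 0 n.

(** Rotating the spectral variable makes the coefficients of the block constant; the earlier blocks
    enter only through the starting value [y]. *)
Lemma scan_block (phi : R) l : (l < k)%N -> exists2 y : C, cabs y <= 1 &
  A phi (l.+1 * blen) - A phi (l * blen) =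
  chain_arg (fun=> real_complex R e) (expi (phi - scan_angle l)) y blen.
Proof.
move=> lk; exists (chain G (expi phi) 0 (l * blen)).
  apply: chain_le1; [by move=> m; exact: cabs_scan_lt1|by rewrite cabs_expi|].
  by rewrite cabs0 ler01.
rewrite /A mulSn addnC chain_arg_addn addrC addKr.
rewrite expiD expiN -chain_arg_modulated ?sqmod_expi //.
apply: eq_chain_arg => m mb; rewrite /G /=.
have b0 : (0 < blen)%N by exact: leq_ltn_trans mb.
have -> : (l * blen + m < k * blen)%N.
  apply: (@leq_trans (l.+1 * blen)); first by rewrite mulSn addnC ltn_add2r.
  by rewrite leq_mul2r lk orbT.
by rewrite divnMDl // divn_small // addn0 modnMDl modn_small.
Qed.

(** The sign [s] records the side of the frequency, the kernel being odd. The main term is at least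
    $\frac{w^2}{k}\cdot\frac1{2x}$ with $x\le 2\pi(j+1)/k$, that is $w^2/(4\pi(j+1))$, and
    $4\pi<16$. *)
Lemma scan_gain (phi s x : R) l j : (l < k)%N -> (0 < j <= q)%N ->
  s = 1 \/ s = -1 -> phi - scan_angle l = s * x ->
  j%:R * h <= x <= j.+1%:R * h ->
  w ^+ 2 / 16 * (j.+1%:R)^-1 - (q.+1%:R)^-1 <=
  s * (A phi (l.+1 * blen) - A phi (l * blen)).
Proof.
move=> lk /andP[j0 jq] hs xE /andP[x1 x2].
have p0 := pi_gt0 R; have p2 := pi_ge2 R.
have p4 : pi < 4 :> R by have := pihalf_lt2 R; lra.
have h0 : 0 < h by rewrite divr_gt0 // mulr_gt0.
have xh : h <= x.
  by apply: le_trans x1; rewrite ler_peMl ?(ltW h0) // ler1n.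
have x0 : 0 < x by exact: lt_le_trans xh.
have kE : k%:R = 8 * q.+1%:R :> R by rewrite /k natrM.
have q0 : 0 < q.+1%:R :> R by rewrite ltr0n.
have x11 : x <= 1.
  apply: le_trans x2 _.
  apply: (@le_trans _ _ (q.+1%:R * h)).
    by rewrite ler_wpM2r ?ler_nat // ltW.
  rewrite /h kE.
  have -> : q.+1%:R * (2 * pi / (8 * q.+1%:R)) = pi / 4 :> R.
    by field; rewrite gt_eqF.
  by lra.
have [y y1 ->] := scan_block phi lk; rewrite xE.
have xi : 0 <= x <= 1 by rewrite ltW.
have kap := cabs_1Bexpi_ge xi; have ker : (2 * x)^-1 <= complex.Im (expi x / (1 - expi x)).
  by apply: cauchy_kernel_ge; rewrite x0.
have [kapE kerE] : cabs (1 - expi (s * x)) = cabs (1 - expi x) /\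
    s * complex.Im (expi (s * x) / (1 - expi (s * x))) =
    complex.Im (expi x / (1 - expi x)).
  case: hs => ->; first by rewrite !mul1r.
  rewrite !mulN1r !cauchy_kernelE cosN sinN mulNr opprK; split=> //.
  have -> : 1 - expi (- x) = conjc (1 - expi x) by rewrite expiN rmorphB rmorph1.
  exact: cabsJ.
have kk : 2 / k%:R <= cabs (1 - expi x).
  apply: le_trans kap; rewrite ler_pdivlMr // mulrAC ler_pdivrMr //.
  have : h * k%:R <= x * k%:R by rewrite ler_wpM2r // ltW.
  by rewrite /h divfK ?gt_eqF //; lra.
have kpos : 0 < cabs (1 - expi x) by apply: lt_le_trans kk; rewrite divr_gt0.
have kne : expi (s * x) != 1.
  by rewrite eq_sym -subr_eq0 -cabs_gt0 kapE.
have w2 : w ^+ 2 <= 64^-1.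
  have : w * w <= 8^-1 * 8^-1 by apply: ler_pM => //; exact: ltW.
  by rewrite -expr2 => h1; apply: le_trans h1 _; lra.
have c1 : 48 * blen%:R * e ^+ 2 <= cabs (1 - expi (s * x)).
  rewrite -mulrA blen_e2 kapE; apply: le_trans kk; rewrite mulrA.
  by rewrite ler_pM2r ?invr_gt0 //; lra.
have rtE : rt%:R = 5 * q.+1%:R * k%:R :> R by rewrite /rt !natrM.
have ek : e * (5 * q.+1%:R) = w / k%:R.
  by rewrite /e rtE; field; rewrite !gt_eqF.
have ek2 : e * k%:R * (5 * q.+1%:R) <= 8^-1.
  by rewrite mulrAC ek divfK ?gt_eqF.
have q1 : 1 <= q.+1%:R :> R by rewrite ler1n.
have ekp : 0 < e * k%:R by exact: mulr_gt0.
have ek3 : e <= 2 / k%:R / 8.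
  rewrite mulrAC ler_pdivlMr //; nra.
have c2 : e <= cabs (1 - expi (s * x)) / 8.
  by rewrite kapE; apply: le_trans ek3 _; rewrite ler_pM2r ?invr_gt0.
have := block_estimate e_gt0 e_lt1 (sqmod_expi _) kne c1 c2 y1.
rewrite blen_e2 kapE; set B := chain_arg _ _ _ _; set I0 := complex.Im _ in kerE *.
have err : 10 * e / cabs (1 - expi x) <= (q.+1%:R)^-1.
  rewrite ler_pdivrMr //.
  apply: (@le_trans _ _ ((q.+1%:R)^-1 * (2 / k%:R))); last first.
    by rewrite ler_wpM2l // invr_ge0 ltW.
  have -> : (q.+1%:R)^-1 * (2 / k%:R) = 2 / (k%:R * q.+1%:R) :> R.
    by field; rewrite !gt_eqF.
  by rewrite ler_pdivlMr ?mulr_gt0 //; lra.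
move=> bl; have {bl} bl := le_trans bl err.
have sB : `|s * B - w ^+ 2 / k%:R * (s * I0)| <= (q.+1%:R)^-1.
  have -> : s * B - w ^+ 2 / k%:R * (s * I0) = s * (B - w ^+ 2 / k%:R * I0) by ring.
  by rewrite normrM; case: hs => ->; rewrite ?normrN normr1 mul1r.
rewrite kerE in sB.
have main : w ^+ 2 / 16 * (j.+1%:R)^-1 <=
    w ^+ 2 / k%:R * complex.Im (expi x / (1 - expi x)).
  rewrite -[w ^+ 2 / 16 * _]mulrA -[w ^+ 2 / k%:R * _]mulrA ler_wpM2l ?sqr_ge0 //.
  apply: (@le_trans _ _ ((k%:R)^-1 * (2 * x)^-1)); last first.
    by rewrite ler_wpM2l // invr_ge0 ltW.
  have j1 : 0 < j.+1%:R :> R by rewrite ltr0n.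
  rewrite -!invfM lef_pV2 ?posrE ?mulr_gt0 //.
  have : x * k%:R <= j.+1%:R * (2 * pi).
    have : x * k%:R <= j.+1%:R * h * k%:R by rewrite ler_wpM2r // ltW.
    by rewrite -mulrA /h divfK ?gt_eqF.
  nra.
move: sB main; set P := w ^+ 2 / k%:R * _; set Q := w ^+ 2 / 16 * _.
rewrite ler_norml => /andP[sB _] main.
rewrite lerBlDr; apply: le_trans main _.
by move: sB; rewrite lerBrDr addrC lerBlDr.
Qed.

(** The summand 1 in the hypothesis pays for the errors $1/(q+1)$ of the [q] blocks. *)
Lemma scan_large (phi M : R) : 0 <= phi -> phi < 2 * pi ->
  2 * M + 1 <= w ^+ 2 / 16 * \sum_(i < q) (i.+2%:R)^-1 ->
  exists n0 n1 : nat, 2 * M <= `|A phi n1 - A phi n0|.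
Proof.
move=> ph0 ph2 hM; have p0 := pi_gt0 R.
have h0 : 0 < h by rewrite divr_gt0 // mulr_gt0.
have kh : k%:R * h = 2 * pi by rewrite /h mulrC divfK // gt_eqF.
have dv0 : 0 <= phi / h by rewrite divr_ge0 // ltW.
have := truncn_itv dv0; set J := Num.trunc _.
rewrite ler_pdivlMr // ltr_pdivrMr // => /andP[J1 J2].
have Jk : (J < k)%N.
  rewrite -(ltr_nat R) -(ltr_pM2r h0) kh; exact: le_lt_trans ph2.
have b0 : (0 < blen)%N by rewrite /blen /k.
have hsum : \sum_(i < q) (w ^+ 2 / 16 * (i.+2%:R)^-1 - (q.+1%:R)^-1) >= 2 * M.
  rewrite sumrB -mulr_sumr sumr_const card_ord -[_ *+ q]mulr_natl.
  have : q%:R * (q.+1%:R)^-1 <= 1 :> R.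
    by rewrite ler_pdivrMr ?ltr0n // mul1r ler_nat.
  by move=> h1; rewrite lerBrDr; apply: le_trans hM; rewrite lerD2l.
have [qJ|qJ] := leqP q J.
(* The blocks $J-q,\dots,J-1$ lie below $\phi$. Block [J] is left out, since $\phi$ may be
   arbitrarily close to its frequency. *)
- exists ((J - q) * blen)%N, (J * blen)%N.
  apply: le_trans (ler_norm _).
  have := @ler_telescope (fun i => A phi ((J - q + i) * blen))
    (fun i => w ^+ 2 / 16 * ((q - i).+1%:R)^-1 - (q.+1%:R)^-1) q.
  rewrite addn0 subnK // => tl; apply: le_trans (tl _).
    apply: le_trans hsum _; rewrite (reindex_inj rev_ord_inj) /=.
    apply: ler_sum => i _; have iq := ltn_ord i.
    by rewrite -subSn // subnSK // subSn // ltnW.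
  move=> i iq; rewrite addnS -[leRHS]mul1r.
  apply: (@scan_gain phi 1 (phi - scan_angle (J - q + i))) => //.
  + by apply: leq_ltn_trans Jk; rewrite -[leqRHS](subnK qJ) leq_add2l ltnW.
  + by rewrite subn_gt0 iq leq_subr.
  + by left.
  + by rewrite mul1r.
  + have -> : scan_angle (J - q + i) = J%:R * h - (q - i)%:R * h.
      rewrite /scan_angle -mulrBl -natrB; last exact: leq_trans (leq_subr _ _) qJ.
      by rewrite addnBAC // subnBA // ltnW.
    have e1 : J.+1%:R * h = J%:R * h + h by rewrite -natr1; ring.
    rewrite e1 in J2.
    by rewrite -[(q - i).+1%:R]natr1; apply/andP; split; lra.
(* With fewer than [q] blocks available below, the [q] blocks from $J+2$ on are used; block $J+1$
   may be closer than one spacing. Their contributions are negative, hence the sign $-1$. *)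
- exists (J.+2 * blen)%N, ((J.+2 + q) * blen)%N.
  rewrite distrC; apply: le_trans (ler_norm _).
  have := @ler_telescope (fun i => - A phi ((J.+2 + i) * blen))
    (fun i => w ^+ 2 / 16 * (i.+2%:R)^-1 - (q.+1%:R)^-1) q.
  rewrite addn0 => tl; have {tl} : \sum_(i < q) (w ^+ 2 / 16 * (i.+2%:R)^-1 - (q.+1%:R)^-1) <=
    - A phi ((J.+2 + q) * blen) - - A phi (J.+2 * blen).
    apply: tl => i iq; rewrite addnS.
    have -> (a b : R) : - a - - b = -1 * (a - b) by ring.
    apply: (@scan_gain phi (-1) (scan_angle (J.+2 + i) - phi)) => //.
    + apply: (@leq_trans (q.+1 + q.+1)); last by rewrite addnn -mul2n leq_mul2r orbT.
      by rewrite -[leqLHS]addnS; apply: leq_add; [|exact: leqW].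
    + by right.
    + by rewrite mulN1r opprB.
    + have -> : scan_angle (J.+2 + i) = J%:R * h + i%:R * h + 2 * h.
        by rewrite /scan_angle natrD -[J.+2%:R]natr1 -[J.+1%:R]natr1; ring.
      have e1 : J.+1%:R * h = J%:R * h + h by rewrite -natr1; ring.
      rewrite e1 in J2; rewrite -[i.+2%:R]natr1 -[i.+1%:R]natr1.
      by apply/andP; split; lra.
  by lra.
Qed.

End Construction.

Lemma arg_astar_unbounded (R : realType) (omega M : R) : 0 < omega -> 0 < M ->
  exists F : int -> R[i],
    [/\ Sstar F, (l2normsq F <= (omega ^+ 2)%:E)%E &
        forall z, sqmod z = 1 ->
          exists N, M <= `|arg_astar (trunc F N) N z|].
Proof.
(* The norm constraint is only an upper bound, so a smaller norm, as the block estimate demands, is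
   admissible. *)
move=> om0 M0; pose w := Num.min omega 8^-1.
have w0 : 0 < w by rewrite lt_min om0 /= invr_gt0 ltr0n.
have w8 : w <= 8^-1 by rewrite ge_min lexx orbT.
have wom : w <= omega by rewrite ge_min lexx.
have [q hq] := harmonic_unbounded ((2 * M + 1) / (w ^+ 2 / 16)).
have c0 : 0 < w ^+ 2 / 16 by rewrite divr_gt0 // exprn_gt0.
rewrite ler_pdivrMr // [leRHS]mulrC in hq.
exists (scan w q); split.
- exact: scan_Sstar.
- apply: le_trans (scan_l2 q w0) _; rewrite lee_fin.
  by apply: lerXn2r; rewrite ?nnegrE // ltW.
- move=> z /circle_param [phi /andP[ph0 ph2] ->].
  have [n0 [n1 hn]] := scan_large w0 w8 ph0 ph2 hq.
  pose A n := chain_arg (fun m => scan w q m%:Z) (expi phi) 0 n.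
  have AE N : arg_astar (trunc (scan w q) N) N (expi phi) = A N.+1.
    by apply: arg_astarE => //; [case|move=> n; exact: cabs_scan_lt1].
  (* The truncation at [N] corresponds to $N+1$ coefficients, so $n=0$ is not a truncation; it is
     excluded because [A 0 = 0] while $M>0$. *)
  have key n : M <= `|A n| ->
      exists N, M <= `|arg_astar (trunc (scan w q) N) N (expi phi)|.
    case: n => [|n hA]; last by exists n; rewrite AE.
    by rewrite /A /chain_arg big_ord0 normr0 leNgt M0.
  have [h1|h1] := leP M `|A n1|; first exact: key h1.
  apply: (@key n0); move: hn; rewrite -/(A n1) -/(A n0) => hn.
  by have := le_trans hn (ler_normB _ _); lra.
Qed.

Theorem theorem2p3 (R : realType) (I : set R[i]) (omega : R) :
  circ_arc I -> I `<=` @circleT R -> I <> @circleT R -> 0 < omega ->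
  ereal_sup
    [set ereal_inf
       [set ereal_sup
          [set (`| arg_astar (trunc F N) N z |)%:E | N in [set: nat]]
       | z in I]
    | F in [set F : int -> R[i] | Sstar F /\ (l2normsq F <= (omega ^+ 2)%:E)%E]]
  = +oo%E.
Proof.
move=> _ IT _ om0; apply/eqyP => M M0.
have [F [FS F2 hF]] := arg_astar_unbounded om0 M0.
set S := (X in ereal_sup X).
apply: le_trans (ereal_sup_ubound (S := S) _); last by exists F.
apply: le_ereal_inf_tmp => _ [z Iz <-].
have [N hN] := hF z (IT z Iz).
apply: (@le_trans _ _ (`|arg_astar (trunc F N) N z|)%:E).
  by rewrite lee_fin.
by apply: ereal_sup_ubound; exists N.
Qed.
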